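(* Let $x,y,z_1,z_2,z_3$ be indeterminates. For every integer $n\ge 2$, the triply-refined ASM generating function satisfies $$\begin{aligned} &y(z_2-z_1)z_3\,Z^{\mathrm{tri}}_n(x,y;z_1,z_2,z_3)\,Z_{n-1}(x,y)=\\ &(z_1-1)\bigl((z_2-1)(z_3-1)-yz_2z_3\bigr)\,Z^{\mathrm{adj}}_n(x,y;z_1,z_3)\,Z_{n-1}(x,y;z_2)\\ &-(z_2-1)\bigl(x(z_1-1)(z_3-1)-y\bigr)\,z_1z_3\,\widetilde{Z}^{\mathrm{adj}}_n(x,y;z_2,z_3)\,Z_{n-1}(x,y;z_1)\\ &-(z_1-1)(z_2-1)(z_3-1)\,Z_{n-1}(x,y;z_2)\,Z_{n-1}(x,y)\\ &+(z_1-1)(z_2-1)(z_3-1)\,z_1z_2^{n-1}(xz_3)^n\,Z_{n-1}(x,y;z_1)\,Z_{n-1}(x,y). \end{aligned}$$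
   Context: An alternating sign matrix (ASM) is a square matrix with entries in $\{0,1,-1\}$ such that along each row and each column the nonzero entries alternate in sign and sum to $1$. $\mathrm{ASM}(n)$ is the set of $n\times n$ ASMs. The first and last rows and columns of an ASM each contain exactly one $1$, all other entries there being $0$. For $A\in\mathrm{ASM}(n)$ define: $\nu(A)=\sum_{1\le i<i'\le n,\;1\le j'\le j\le n}A_{ij}A_{i'j'}$ (a nonnegative integer); $\mu(A)=$ number of $-1$'s in $A$; $\rho_{\mathrm T}(A)=$ number of $0$'s to the left of the $1$ in the top row; $\rho_{\mathrm R}(A)=$ number of $0$'s below the $1$ in the right-most column; $\rho_{\mathrm B}(A)=$ number of $0$'s to the right of the $1$ in the bottom row; $\rho_{\mathrm L}(A)=$ number of $0$'s above the $1$ in the left-most column. Generating functions (for $n\ge1$): $Z^{\mathrm{quad}}_n(x,y;z_1,z_2,z_3,z_4)=\sum_{A\in\mathrm{ASM}(n)}x^{\nu(A)}y^{\mu(A)}z_1^{\rho_{\mathrm T}(A)}z_2^{\rho_{\mathrm R}(A)}z_3^{\rho_{\mathrm B}(A)}z_4^{\rho_{\mathrm L}(A)}$; $Z^{\mathrm{tri}}_n(x,y;z_1,z_2,z_3)=Z^{\mathrm{quad}}_n(x,y;z_1,1,z_2,z_3)$; $Z^{\mathrm{adj}}_n(x,y;z_1,z_2)=Z^{\mathrm{quad}}_n(x,y;z_1,1,1,z_2)$; $\widetilde{Z}^{\mathrm{adj}}_n(x,y;z_1,z_2)=Z^{\mathrm{quad}}_n(x,y;z_1,z_2,1,1)$;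 $Z_n(x,y;z)=Z^{\mathrm{quad}}_n(x,y;z,1,1,1)$; $Z_n(x,y)=Z^{\mathrm{quad}}_n(x,y;1,1,1,1)$. *)

(* Defs.v *)
From HB Require Import structures.
From mathcomp Require Import all_boot all_order all_algebra.
From mathcomp Require Export mpoly.

Set Implicit Arguments.
Unset Strict Implicit.
Unset Printing Implicit Defensive.

Import Order.TTheory GRing.Theory Num.Theory.
Local Open Scope ring_scope.

Definition alternating (s : seq int) : bool :=
  sorted (fun a b => a * b < 0) [seq a <- s | a != 0].

Definition asm_line (s : seq int) : bool :=
  alternating s && (\sum_(a <- s) a == 1).

Definition is_asm (n : nat) (A : 'M[int]_n) : bool :=
  [&& [forall i, forall j, A i j \in [:: 0; 1; -1]],
      [forall i, asm_line [seq A i j | j <- enum 'I_n]]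
    & [forall j, asm_line [seq A i j | i <- enum 'I_n]]].

(* The subtype of int with elements 0, 1, -1: it is a finType, so that the
   matrices with such entries form a finType over which one can sum. *)
Definition asm_entry : finType := seq_sub [:: 0; 1; -1 : int].

Definition int_mx (n : nat) (A : 'M[asm_entry]_n) : 'M[int]_n :=
  map_mx (fun a : asm_entry => ssval a) A.

Definition ASM (n : nat) : {set 'M[asm_entry]_n} :=
  [set A | is_asm (int_mx A)].

Definition nuz (n : nat) (A : 'M[int]_n) : int :=
  \sum_(i < n) \sum_(i' < n | (i < i')%N) \sum_(j < n)
    \sum_(j' < n | (j' <= j)%N) A i j * A i' j'.

(* The absolute value only casts to nat: nuz is nonnegative on ASMs. *)
Definition nu (n : nat) (A : 'M[int]_n) : nat := `|nuz A|%N.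

Definition mu (n : nat) (A : 'M[int]_n) : nat :=
  #|[set p : 'I_n * 'I_n | A p.1 p.2 == -1]|.

(* As n is not of the form m.+1, the first and last indices of 'I_n are
   singled out by k == 0 and k.+1 == n on the underlying naturals. *)
Definition rhoT (n : nat) (A : 'M[int]_n) : nat :=
  #|[set j : 'I_n | [exists i : 'I_n, exists j' : 'I_n,
      [&& i == 0%N :> nat, A i j' == 1, (j < j')%N & A i j == 0]]]|.

Definition rhoR (n : nat) (A : 'M[int]_n) : nat :=
  #|[set i : 'I_n | [exists j : 'I_n, exists i' : 'I_n,
      [&& j.+1 == n, A i' j == 1, (i' < i)%N & A i j == 0]]]|.

Definition rhoB (n : nat) (A : 'M[int]_n) : nat :=
  #|[set j : 'I_n | [exists i : 'I_n, exists j' : 'I_n,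
      [&& i.+1 == n, A i j' == 1, (j' < j)%N & A i j == 0]]]|.

Definition rhoL (n : nat) (A : 'M[int]_n) : nat :=
  #|[set i : 'I_n | [exists j : 'I_n, exists i' : 'I_n,
      [&& j == 0%N :> nat, A i' j == 1, (i < i')%N & A i j == 0]]]|.

Definition Zquad (R : comNzRingType) (n : nat) (x y z1 z2 z3 z4 : R) : R :=
  \sum_(A in ASM n)
    x ^+ nu (int_mx A) * y ^+ mu (int_mx A)
    * z1 ^+ rhoT (int_mx A) * z2 ^+ rhoR (int_mx A)
    * z3 ^+ rhoB (int_mx A) * z4 ^+ rhoL (int_mx A).

Definition Ztri (R : comNzRingType) (n : nat) (x y z1 z2 z3 : R) : R :=
  Zquad n x y z1 1 z2 z3.

Definition Zadj (R : comNzRingType) (n : nat) (x y z1 z2 : R) : R :=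
  Zquad n x y z1 1 1 z2.

Definition Zadjt (R : comNzRingType) (n : nat) (x y z1 z2 : R) : R :=
  Zquad n x y z1 z2 1 1.

Definition Zref (R : comNzRingType) (n : nat) (x y z : R) : R :=
  Zquad n x y z 1 1 1.

Definition Zasm (R : comNzRingType) (n : nat) (x y : R) : R :=
  Zquad n x y 1 1 1 1.

(* Main.v *)
(** An ASM is encoded by its partial row sums (horizontal edges) and partial
    column sums (vertical edges), which all lie in {0, 1}: this is the six-vertex
    model with domain wall boundary.  Since [nu] is the sum over all cells of
    (vertical edge above) * (horizontal edge to the right), ASMs get the weight
    x^nu y^mu when the vertices are weighted by 1 and x (all edges off, all on),
    1 and 1 (straight lines), 1 and y (entries 1 and -1).

    Put k = 1 + x - y and attach a parameter z to every row and w to every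
    column, the four non-turning weights being z - w, x (z - w) and (twice)
    b(z, w) = 1 - k w + x z w.  These weights satisfy the Yang-Baxter equation,
    and the ASM weights are recovered at z = 1, w = 0.  A row with parameter z
    counts the zeros before the 1 of the first row, or after the 1 of the last
    one, with weight z; a first column with suitable parameter w does the same
    for the left-most column, up to explicit corrections at the two corners.

    With ab(z, w) = (z - w) b(z, w), the partition function Z satisfies
      (d - c) (v1 - v2) Z(c, d, zs; v1, v2, vs) Z(zs; vs)
        = ab(d, v1) ab(c, v2) Z(c, zs; v1, vs) Z(d, zs; v2, vs)
          - ab(c, v1) ab(d, v2) Z(d, zs; v1, vs) Z(c, zs; v2, vs).
    Both sides are polynomials in v1 of degree at most the number of rows, and
    they agree at v1 = v2 and at the row parameters, where the first column
    freezes; there the identity reduces to smaller instances.  It says that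
    Z(c, d, zs; v, vs) is, up to factors, an alternating form
    f(c) g(d) - f(d) g(c) with g(c) given by Z(c, zs; vs); the resulting
    three-term relation between the rows z1, z2 and 1 is the theorem. *)

Require Import Defs.
From mathcomp Require Import all_boot all_order all_algebra.
From mathcomp Require Import mpoly fraction.
From mathcomp Require Import ring zify.

Set Implicit Arguments.
Unset Strict Implicit.
Unset Printing Implicit Defensive.

Import Order.TTheory GRing.Theory Num.Theory.
Local Open Scope ring_scope.

(** * Lattice partition functions and exchange of rows *)

Fixpoint words (T : Type) (E : seq T) (n : nat) : seq (seq T) :=
  if n is m.+1 then [seq a :: w | a <- E, w <- words E m] else [:: [::]].

Lemma big_words (V : nmodType) (T : Type) (E : seq T) n (F : seq T -> V) :
  \sum_(w <- words E n.+1) F w = \sum_(a <- E) \sum_(w <- words E n) F (a :: w).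
Proof. by rewrite /= big_allpairs_dep. Qed.

Lemma size_words (T : eqType) (E : seq T) n w : w \in words E n -> size w = n.
Proof.
elim: n w => [|n IHn] w /=; first by rewrite inE => /eqP->.
by case/allpairsP => -[a v] [_ /= Hv ->] /=; rewrite (IHn v).
Qed.

Lemma big_words0 (V : nmodType) (T : Type) (E : seq T) (F : seq T -> V) :
  \sum_(w <- words E 0) F w = F [::].
Proof. by rewrite big_seq1. Qed.

Arguments words : simpl never.

Lemma eq_big_words (V : nmodType) (T : eqType) (E : seq T) n (F G : seq T -> V) :
  (forall w, size w = n -> F w = G w) ->
  \sum_(w <- words E n) F w = \sum_(w <- words E n) G w.
Proof. by move=> eqFG; apply: eq_big_seq => w /size_words /eqFG. Qed.

Definition bits := [:: true; false].

Lemma big_bits (V : nmodType) (F : bool -> V) : \sum_(b <- bits) F b = F true + F false.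
Proof. by rewrite !big_cons big_nil addr0. Qed.

Section Lattice.

Variables (R : comNzRingType) (A B : Type).
Variable L : A -> B -> bool -> bool -> bool -> bool -> R.

(* L a b h v h' v' is the weight of the vertex in row a and column b with left,
   top, right and bottom edges h, v, h' and v'. *)
Fixpoint transfer a (cs : seq B) (h e : bool) (s t : seq bool) : R :=
  match cs, s, t with
  | [::], [::], [::] => (h == e)%:R
  | c :: cs, v :: s, v' :: t =>
      \sum_(h' <- bits) L a c h v h' v' * transfer a cs h' e s t
  | _, _, _ => 0
  end.

Fixpoint part (rs : seq A) (cs : seq B) (s : seq bool) : R :=
  if rs is r :: rs then
    \sum_(t <- words bits (size cs)) transfer r cs false true s t * part rs cs t
  else (all id s)%:R.

(* Domain wall boundary: edges are off on the left and at the top, on at the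
   right and at the bottom. *)
Definition dwbc rs cs := part rs cs (nseq (size cs) false).

Definition dbl a b cs (h k : bool * bool) s r :=
  \sum_(t <- words bits (size cs)) transfer a cs h.1 k.1 s t * transfer b cs h.2 k.2 t r.

Definition dbl1 a b c (h k : bool * bool) s r :=
  \sum_(t <- bits) L a c h.1 s k.1 t * L b c h.2 t k.2 r.

Lemma big_bool2 (V : nmodType) (F : bool * bool -> V) :
  \sum_p F p = F (true, true) + F (true, false) + (F (false, true) + F (false, false)).
Proof.
rewrite (eq_bigr (fun p => F (p.1, p.2))); last by case.
by rewrite -(pair_bigA _ (fun a b => F (a, b))) /= !big_bool.
Qed.

Lemma dbl_cons a b c cs h k s0 s r0 r :
  dbl a b (c :: cs) h k (s0 :: s) (r0 :: r) =
  \sum_m dbl1 a b c h m s0 r0 * dbl a b cs m k s r.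
Proof.
rewrite /dbl big_words exchange_big /= -/(size cs).
under [in RHS]eq_bigr do rewrite mulr_sumr.
rewrite [RHS]exchange_big /=; apply: eq_bigr => w _.
rewrite big_bool2 /dbl1 /= !big_bits.
ring.
Qed.

(** The cross [Rm] passes a single column by the hypothesis [ybe], and [dbl_cons] lets it travel
    through all columns in turn. *)
Lemma dbl_exchange (Rm : bool * bool -> bool * bool -> R) a b cs h k s r :
  (forall c h k s r, \sum_p Rm h p * dbl1 a b c p k s r
                   = \sum_p dbl1 b a c h p s r * Rm p k) ->
  size s = size cs -> size r = size cs ->
  \sum_p Rm h p * dbl a b cs p k s r = \sum_p dbl b a cs h p s r * Rm p k.
Proof.
move=> ybe; elim: cs h s r => [|c cs IHcs] h [|s0 s] [|r0 r] //=.
  rewrite /dbl /= !big_bool2 !big_words0 /=.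
  by case: h k => -[] [] [[] []] /=; rewrite ?(mulr0, mulr1, mul0r, mul1r, addr0, add0r).
move=> [ss] [sr].
under eq_bigr do rewrite dbl_cons mulr_sumr.
rewrite exchange_big /=.
under eq_bigr => m _.
  under eq_bigr do rewrite mulrA.
  rewrite -mulr_suml ybe mulr_suml.
  under eq_bigr do rewrite -mulrA.
  over.
rewrite exchange_big /=.
under eq_bigr do rewrite -mulr_sumr IHcs // mulr_sumr.
rewrite exchange_big /=; apply: eq_bigr => m _.
by rewrite dbl_cons mulr_suml; apply: eq_bigr => p _; rewrite mulrA.
Qed.

(** The cross is attached on the left, where both edges are off, and comes out on the right, where
    both are on. On these boundary states it acts by the same scalar [rho], which stays as a factor
    because it need not be cancellable. *)
Lemma part_swap (Rm : bool * bool -> bool * bool -> R) (rho : R) a b rs cs s :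
  (forall c h k s r, \sum_p Rm h p * dbl1 a b c p k s r
                   = \sum_p dbl1 b a c h p s r * Rm p k) ->
  (forall p, Rm (false, false) p = if p == (false, false) then rho else 0) ->
  (forall p, Rm p (true, true) = if p == (true, true) then rho else 0) ->
  size s = size cs ->
  rho * part (a :: b :: rs) cs s = rho * part (b :: a :: rs) cs s.
Proof.
move=> ybe R00 R11 ss.
have part2 c d : part (c :: d :: rs) cs s =
    \sum_(r <- words bits (size cs)) dbl c d cs (false, false) (true, true) s r * part rs cs r.
  rewrite /=; under eq_bigr do rewrite mulr_sumr.
  rewrite exchange_big /=; apply: eq_bigr => r _.
  by rewrite /dbl mulr_suml; apply: eq_bigr => t _; rewrite mulrA.
rewrite !part2 !mulr_sumr; apply: eq_big_words => r sr.
have := @dbl_exchange Rm a b cs (false, false) (true, true) s r ybe ss sr.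
rewrite (bigD1 (false, false)) //= R00 eqxx big1 ?addr0; last first.
  by move=> p /negPf Np; rewrite R00 Np mul0r.
rewrite (bigD1 (true, true)) //= R11 eqxx big1 ?addr0; last first.
  by move=> p /negPf Np; rewrite R11 Np mulr0.
by rewrite !mulrA => ->; rewrite [_ * rho]mulrC.
Qed.

End Lattice.

(** * Six-vertex weights *)

(** Serves for evaluations, for the embedding of constants into polynomials and for relabelling rows
    and columns. *)
Lemma part_map (R S : comNzRingType) (A B A' B' : Type) (phi : {rmorphism R -> S})
    (f : A -> A') (g : B -> B') L L' rs cs s :
  (forall a b h v h' v', L' (f a) (g b) h v h' v' = phi (L a b h v h' v')) ->
  part L' (map f rs) (map g cs) s = phi (part L rs cs s).
Proof.
move=> eqL; elim: rs s => [|r rs IHrs] s /=; first by rewrite rmorph_nat.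
rewrite size_map rmorph_sum /=; apply: eq_bigr => t _.
rewrite rmorphM IHrs; congr (_ * _).
elim: cs false s t {IHrs} => [|c cs IHcs] h [|v s] [|v' t] //=; rewrite ?rmorph0 ?rmorph_nat //.
by rewrite rmorph_sum; apply: eq_bigr => h' _; rewrite rmorphM eqL IHcs.
Qed.

Section Ice.

Variables (R : comNzRingType) (A B : Type).
Variable L : A -> B -> bool -> bool -> bool -> bool -> R.

Hypothesis ice : forall a b (h v h' v' : bool),
  (h + v' != h' + v)%N -> L a b h v h' v' = 0.

(** With the left edge on and the top edges off, the ice rule forces the row straight to the
    right. *)
Lemma transfer_frozen a cs t :
  transfer L a cs true true (nseq (size cs) false) t =
  \prod_(c <- cs) L a c true false true false * (t == nseq (size cs) false)%:R.
Proof.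
elim: cs t => [|c cs IHcs] [|v t] /=; rewrite ?big_nil ?mul1r ?mulr0 //.
rewrite big_bits big_cons IHcs (@ice _ _ _ _ false); last by case: v.
rewrite mul0r addr0; case: v => /=; last by rewrite !mulrA.
by rewrite ice // mul0r mulr0.
Qed.

Lemma big_words_pred1 n t (F : seq bool -> R) : size t = n ->
  \sum_(w <- words bits n) (w == t)%:R * F w = F t.
Proof.
elim: n t F => [|n IHn] [|b t] F //= => [_|[st]]; first by rewrite big_seq1 mul1r.
rewrite big_words big_bits.
by case: b => /=; rewrite IHn // big1 ?addr0 ?add0r // => w _; rewrite mul0r.
Qed.

Lemma sum_transfer_frozen a cs (F : seq bool -> R) :
  \sum_(t <- words bits (size cs)) transfer L a cs true true (nseq (size cs) false) t * F t =
  \prod_(c <- cs) L a c true false true false * F (nseq (size cs) false).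
Proof.
under [LHS]eq_bigr do rewrite transfer_frozen -mulrA.
by rewrite -mulr_sumr big_words_pred1 ?size_nseq.
Qed.

(** The left boundary edges are off, so by the ice rule an on edge at the top of the first column
    runs straight down. *)
Lemma part_col_true rs c cs s :
  part L rs (c :: cs) (true :: s) =
  \prod_(r <- rs) L r c false true false true * part L rs cs s.
Proof.
elim: rs s => [|r rs IHrs] s; first by rewrite big_nil mul1r.
rewrite [part L (r :: rs) (c :: cs) _]/part -/(part L) big_words big_bits.
rewrite [X in _ + X]big1 ?addr0; last first.
  by move=> t _; rewrite /= big_bits !ice // !mul0r addr0 mul0r.
rewrite big_cons /= mulr_sumr; apply: eq_bigr => t _.
by rewrite /= IHrs big_bits (@ice _ _ _ _ true) // mul0r add0r; ring.
Qed.

(** With left and top edges off, the corner vertex is all off or is a turn, the 1 of the first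
    column. After the turn the rest of the column is frozen by [part_col_true]. *)
Lemma part_col_false r rs c cs s :
  part L (r :: rs) (c :: cs) (false :: s) =
  L r c false false false false *
    \sum_(t <- words bits (size cs)) transfer L r cs false true s t * part L rs (c :: cs) (false :: t)
  + L r c false false true true * \prod_(i <- rs) L i c false true false true *
    \sum_(t <- words bits (size cs)) transfer L r cs true true s t * part L rs cs t.
Proof.
rewrite [LHS]/part -/(part L) big_words big_bits addrC; congr (_ + _).
  rewrite mulr_sumr; apply: eq_bigr => t _.
  by rewrite /= big_bits ice // mul0r add0r mulrA.
rewrite mulr_sumr; apply: eq_bigr => t _.
by rewrite part_col_true /= big_bits (@ice _ _ _ _ false) //; ring.
Qed.

End Ice.

Section Weights.

Variable R : comNzRingType.
Variables x k : R.

(** For [k = 1 + x - y] the values at 1 and 0 are y and 1, so an entry -1 gets weight y at row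
    parameter 1 and column parameter 0. *)
Definition quadw (z : R) := 1 - k * z + x * z ^+ 2.
Definition wtb (z w : R) := 1 - k * w + x * z * w.

Definition wt (z w : R) (h v h' v' : bool) : R :=
  match h, v, h', v' with
  | false, false, false, false => z - w
  | true, true, true, true => x * (z - w)
  | false, true, false, true | true, false, true, false => wtb z w
  | false, false, true, true => 1
  | true, true, false, false => quadw z * quadw w
  | _, _, _, _ => 0
  end.

Lemma wt_ice z w (h v h' v' : bool) : (h + v' != h' + v)%N -> wt z w h v h' v' = 0.
Proof. by case: h v h' v' => -[] [] []. Qed.

Definition Z6v (zs ws : seq R) := dwbc wt zs ws.

(** At equal parameters the weight of an all-off corner vanishes, so the corner holds a 1 and
    freezes the first row and the first column. *)
Lemma Z6v_corner z zs ws :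
  Z6v (z :: zs) (z :: ws) =
  \prod_(u <- zs) wtb u z * \prod_(w <- ws) wtb z w * Z6v zs ws.
Proof.
rewrite /Z6v /dwbc [nseq _ _]/= part_col_false; last exact: wt_ice.
rewrite -/(size ws) (sum_transfer_frozen wt_ice) /= subrr mul0r add0r mul1r.
by rewrite mulrA.
Qed.

(** The cross of two row lines, as a matrix from the pair of horizontal edges on its left to the
    pair on its right. Both edges off and both edges on have the same weight [wtb u u'], as
    [part_swap] requires. *)
Definition rmx (u u' : R) (p q : bool * bool) : R :=
  match p, q with
  | (false, false), (false, false) | (true, true), (true, true) => wtb u u'
  | (false, true), (false, true) => quadw u
  | (true, false), (true, false) => quadw u'
  | (false, true), (true, false) => x * (u - u')
  | (true, false), (false, true) => u - u'
  | _, _ => 0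
  end.

(** Each of the 64 choices of the six outer edges gives a polynomial identity. *)
Lemma yang_baxter u u' w h k' s r :
  \sum_p rmx u u' h p * dbl1 wt u u' w p k' s r =
  \sum_p dbl1 wt u' u w h p s r * rmx u u' p k'.
Proof.
rewrite !big_bool2 /dbl1 !big_bits.
by case: h k' s r => -[] [] [[] []] [] [] /=; rewrite /wtb /quadw; ring.
Qed.

Lemma part_wt_swap u u' zs ws s : size s = size ws ->
  wtb u u' * part wt (u :: u' :: zs) ws s = wtb u u' * part wt (u' :: u :: zs) ws s.
Proof.
apply: (@part_swap R R R wt (rmx u u')); first by move=> *; exact: yang_baxter.
- by move=> [[] []].
- by move=> [[] []].
Qed.

End Weights.

Lemma Z6v_map (R S : comNzRingType) (phi : {rmorphism R -> S}) x k zs ws :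
  Z6v (phi x) (phi k) (map phi zs) (map phi ws) = phi (Z6v x k zs ws).
Proof.
rewrite /Z6v /dwbc size_map; apply: part_map => a b h v h' v'.
case: h v h' v' => -[] [] [] /=; rewrite /quadw /wtb ?rmorph0 ?rmorph1 //;
 by rewrite ?(rmorphM, rmorphB, rmorphD, rmorph1, rmorphXn).
Qed.

(** Equal parameters freeze one corner after another, and the straight weights at 0 are 1. This
    value makes partition functions of small parameters nonzero. *)
Lemma Z6v_nseq0 (R : comNzRingType) (x k : R) n : Z6v x k (nseq n 0) (nseq n 0) = 1.
Proof.
elim: n => [|n IHn] //=.
rewrite Z6v_corner IHn mulr1 !big1_seq ?mulr1 // => u /andP[_ /nseqP[-> _]];
  by rewrite /wtb; ring.
Qed.

(** The left edges of the first column are off, so one of its vertices is a turn of weight 1 and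
    every other one has degree at most 1 in the column parameter. The remaining columns are
    constant. *)
Lemma size_part_poly (R : comNzRingType) (x k : R) zs ws s :
  (size (part (wt x%:P k%:P) (map polyC zs) ('X :: map polyC ws) (false :: s))
    <= size zs)%N.
Proof.
have szB (z : R) : (size (z%:P - 'X)%R <= 2)%N.
  by rewrite (leq_trans (size_polyD _ _)) // size_polyN size_polyX geq_max size_polyC; case: (_ != _).
have szb z : (size (wtb x%:P k%:P z%:P 'X) <= 2)%N.
  rewrite /wtb -!polyCM -addrA -mulNr -mulrDl -polyCN -polyCD.
  rewrite (leq_trans (size_polyD _ _)) // geq_max size_poly1 /=.
  by rewrite mul_polyC (leq_trans (size_scale_leq _ _)) ?size_polyX.
have szM (p q : {poly R}) m n : (size p <= m.+1 -> size q <= n -> size (p * q)%R <= m + n)%N.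
  move=> sp sq; apply: leq_trans (size_polyMleq p q) _; lia.
have part_C zs' t : part (wt x%:P k%:P) (map polyC zs') (map polyC ws) t = (part (wt x k) zs' ws t)%:P.
  apply: part_map => a b h v h' v'.
  by case: h v h' v' => -[] [] [] //=; rewrite /quadw /wtb !(rmorphM, rmorphB, rmorphD, rmorph1, rmorphXn).
have transfer_C z h s' t : transfer (wt x%:P k%:P) z%:P (map polyC ws) h true s' t = (transfer (wt x k) z ws h true s' t)%:P.
  elim: ws h s' t {part_C} => [|w ws' IH] h [|v s'] [|v' t] //=.
    by rewrite polyC_natr.
  rewrite rmorph_sum /=; apply: eq_bigr => h' _; rewrite polyCM IH; congr (_ * _).
  by case: h v h' v' => -[] [] [] //=; rewrite /quadw /wtb !(rmorphM, rmorphB, rmorphD, rmorph1, rmorphXn).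
elim: zs s => [|z zs IHzs] s; first by rewrite /= size_poly0.
rewrite [map _ _]/= part_col_false; last exact: wt_ice.
rewrite (leq_trans (size_polyD _ _)) // geq_max; apply/andP; split.
  apply: (szM _ _ 1%N); first exact: szB.
  apply: (big_ind (fun p : {poly R} => (size p <= size zs)%N)); rewrite ?size_poly0 //.
    by move=> p q sp sq; rewrite (leq_trans (size_polyD _ _)) // geq_max sp.
  move=> t _; apply: (szM _ _ 0%N); last exact: IHzs.
  by rewrite transfer_C size_polyC leq_b1.
rewrite mul1r [size (z :: zs)]/= -addn1; apply: (szM).
  rewrite big_map; elim: zs {IHzs} => [|z' zs IHzs]; first by rewrite big_nil size_poly1.
  by rewrite big_cons /= -[(size zs).+2]add1n; apply: (szM _ _ 1%N); rewrite ?szb.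
under eq_bigr do rewrite transfer_C part_C -polyCM.
by rewrite -rmorph_sum size_polyC leq_b1.
Qed.

(** * Condensation and the three-term relation *)

Definition wtab (R : comNzRingType) (x k z w : R) := (z - w) * wtb x k z w.

Lemma horner_Z6v (R : comNzRingType) (x k v : R) zs ws :
  (Z6v x%:P k%:P zs ws).[v] = Z6v x k (map (horner_eval v) zs) (map (horner_eval v) ws).
Proof. by rewrite -[LHS]/(horner_eval v _) -Z6v_map /= /horner_eval !hornerC. Qed.

Lemma map_horner_polyC (R : comNzRingType) (v : R) (s : seq R) :
  map (horner_eval v) (map polyC s) = s.
Proof. by rewrite -map_comp (@eq_map _ _ (_ \o _) id) ?map_id // => z; exact: hornerC. Qed.

Lemma Z6v_horner (R : comNzRingType) (x k : R) zs ws v :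
  (Z6v x%:P k%:P (map polyC zs) ('X :: map polyC ws)).[v] = Z6v x k zs (v :: ws).
Proof. by rewrite horner_Z6v /= !map_horner_polyC /horner_eval hornerX. Qed.

Section Generic.

Variables (R : idomainType) (S : comNzRingType) (ev : {rmorphism R -> S}).
Variables x k : R.

Notation Z := (Z6v x k).
Notation b := (wtb x k).
Notation ab := (wtab x k).

(* Partition functions of small parameters, and the weights [b] between them, are
   nonzero because they specialize to 1 under ev. *)
Definition small (a : R) := ev a == 0.

Lemma wtb_small_neq0 z w : small w -> b z w != 0.
Proof.
move=> /eqP sw; apply/eqP => /(congr1 ev)/eqP.
by rewrite /wtb !(rmorphD, rmorphN, rmorphM) rmorph1 rmorph0 sw !mulr0 oppr0 !addr0 oner_eq0.
Qed.

Lemma Z6v_small_neq0 zs ws : all small zs -> all small ws -> size zs = size ws -> Z zs ws != 0.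
Proof.
move=> szs sws eqsz; apply/eqP => /(congr1 ev)/eqP.
have map0 s : all small s -> map ev s = nseq (size s) 0.
  by elim: s => //= a s IHs /andP[/eqP-> /IHs->].
by rewrite -Z6v_map !map0 // eqsz Z6v_nseq0 rmorph0 oner_eq0.
Qed.

(** A row [z] is brought to the front by adjacent exchanges, each cancelling a weight [b u z], which
    is nonzero because [z] is small. *)
Lemma part_perm zs zs' ws s : all small zs -> perm_eq zs zs' -> size s = size ws ->
  part (wt x k) zs ws s = part (wt x k) zs' ws s.
Proof.
have cons z l l' : (forall s, size s = size ws -> part (wt x k) l ws s = part (wt x k) l' ws s) ->
    forall s, size s = size ws -> part (wt x k) (z :: l) ws s = part (wt x k) (z :: l') ws s.
  by move=> eql t st; apply: eq_big_words => u su; congr (_ * _); apply: eql.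
have front z l1 l2 : small z -> all small l1 -> forall s, size s = size ws ->
    part (wt x k) (l1 ++ z :: l2) ws s = part (wt x k) (z :: l1 ++ l2) ws s.
  move=> sz; elim: l1 => [|u l1 IHl] // /andP[su /IHl{}IHl] t st.
  rewrite !cat_cons (cons _ _ (z :: l1 ++ l2)) //.
  by apply: (mulfI (wtb_small_neq0 u sz)); rewrite part_wt_swap.
elim: zs zs' s => [|z zs IHzs] zs' s.
  by move=> _ /perm_size/esym/eqP/nilP->.
case/andP=> sz szs pz ss.
have zs'z : z \in zs' by rewrite -(perm_mem pz) mem_head.
case/splitPr: zs'z pz => l1 l2.
rewrite -[z :: l2]cat1s perm_sym perm_catCA perm_cons perm_sym => pz.
have all_l : all small (l1 ++ l2) by rewrite -(perm_all _ pz).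
move: all_l; rewrite all_cat => /andP[sl1 _].
by rewrite cat1s front //; apply: cons => // t st; apply: IHzs.
Qed.

Lemma Z6v_perm zs zs' ws : all small zs -> perm_eq zs zs' -> Z zs ws = Z zs' ws.
Proof. by move=> szs pz; apply: part_perm; rewrite ?size_nseq. Qed.

Definition condensation c d zs v1 v2 vs :=
  (d - c) * (v1 - v2) * Z (c :: d :: zs) (v1 :: v2 :: vs) * Z zs vs =
  ab d v1 * ab c v2 * Z (c :: zs) (v1 :: vs) * Z (d :: zs) (v2 :: vs)
  - ab c v1 * ab d v2 * Z (d :: zs) (v1 :: vs) * Z (c :: zs) (v2 :: vs).

Definition three_term c d e zs v vs :=
  (c - d) * ab e v * Z (c :: d :: zs) (v :: vs) * Z (e :: zs) vs
  + (d - e) * ab c v * Z (d :: e :: zs) (v :: vs) * Z (c :: zs) vs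
  + (e - c) * ab d v * Z (e :: c :: zs) (v :: vs) * Z (d :: zs) vs = 0.

(** Put f_c = ab c u Z(c, zs; v, us) and g_c = ab c v Z(c, zs; u, us). Condensation says that (d -
    c) (v - u) Z(c, d, zs; v, u, us) Z(zs; us) equals f_c g_d - f_d g_c. Multiplied by g_e and
    summed cyclically this gives 0, and the factor (v - u) Z(zs; us) cancels. *)
Lemma three_term_condensation c d e zs v u us :
  v != u -> Z zs us != 0 ->
  condensation c d zs v u us -> condensation d e zs v u us -> condensation e c zs v u us ->
  three_term c d e zs v (u :: us).
Proof.
rewrite /condensation /three_term -subr_eq0 => vu Z0 cd de ec.
apply: (mulfI (mulf_neq0 vu Z0)); rewrite mulr0.
pose lc (p q r : R) := - (p * ab e v * Z (e :: zs) (u :: us) + q * ab c v * Z (c :: zs) (u :: us)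
  + r * ab d v * Z (d :: zs) (u :: us)).
transitivity (lc ((d - c) * (v - u) * Z (c :: d :: zs) (v :: u :: us) * Z zs us)
   ((e - d) * (v - u) * Z (d :: e :: zs) (v :: u :: us) * Z zs us)
   ((c - e) * (v - u) * Z (e :: c :: zs) (v :: u :: us) * Z zs us)).
  by rewrite /lc; ring.
by rewrite cd de ec /lc; ring.
Qed.


(** Condensation enters as a hypothesis, so that the lemma serves both inside the induction proving
    condensation and after it. *)
Lemma three_term_small c d e zs v u us :
  (forall c d v1, small c -> small d -> uniq (c :: d :: zs ++ u :: us) ->
    condensation c d zs v1 u us) ->
  size zs = size us -> all small (c :: d :: e :: zs) -> all small us ->
  v != u -> uniq (c :: d :: e :: zs ++ u :: us) -> three_term c d e zs v (u :: us).
Proof.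
move=> cond sz /and4P[sc sd se szs] sus vu.
rewrite !cons_uniq !inE !negb_or => /and4P[/and3P[cd ce cl] /andP[de dl] el ul].
apply: three_term_condensation => //; first exact: Z6v_small_neq0.
- by apply: cond => //; rewrite !cons_uniq inE negb_or cd cl dl.
- by apply: cond => //; rewrite !cons_uniq inE negb_or de dl el.
- by apply: cond => //; rewrite !cons_uniq inE negb_or eq_sym ce cl el.
Qed.

Definition condensation_poly c d zs v2 vs : {poly R} :=
  let pZ zs ws := Z6v x%:P k%:P (map polyC zs) ('X :: map polyC ws) in
  let pab z := wtab x%:P k%:P z%:P 'X in
  (d - c)%:P * ('X - v2%:P) * pZ (c :: d :: zs) (v2 :: vs) * (Z zs vs)%:P
  - (pab d * (ab c v2)%:P * pZ (c :: zs) vs * (Z (d :: zs) (v2 :: vs))%:P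
     - pab c * (ab d v2)%:P * pZ (d :: zs) vs * (Z (c :: zs) (v2 :: vs))%:P).

Lemma condensation_polyP c d zs v1 v2 vs :
  root (condensation_poly c d zs v2 vs) v1 <-> condensation c d zs v1 v2 vs.
Proof.
rewrite /condensation_poly /condensation rootE.
set p := (X in X.[v1]).
have -> : p.[v1] = (d - c) * (v1 - v2) * Z (c :: d :: zs) (v1 :: v2 :: vs) * Z zs vs -
  (ab d v1 * ab c v2 * Z (c :: zs) (v1 :: vs) * Z (d :: zs) (v2 :: vs)
  - ab c v1 * ab d v2 * Z (d :: zs) (v1 :: vs) * Z (c :: zs) (v2 :: vs)).
  rewrite /p !(hornerD, hornerN, hornerM, hornerC, hornerX) /wtab /wtb !Z6v_horner.
  by rewrite ?(hornerD, hornerN, hornerM, hornerC, hornerX).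
by rewrite subr_eq0; split => /eqP.
Qed.

(** The degree is at most size zs + 2: a linear factor times degree size zs + 1 in the first
    product, a quadratic [pab] times degree size zs in the other two. *)
Lemma size_condensation_poly c d zs v2 vs :
  (size (condensation_poly c d zs v2 vs) <= (size zs).+3)%N.
Proof.
have szM (p q : {poly R}) m n : (size p <= m.+1 -> size q <= n -> size (p * q)%R <= m + n)%N.
  move=> sp sq; apply: leq_trans (size_polyMleq p q) _; lia.
have szC (e : R) : (size e%:P <= 1)%N by rewrite size_polyC leq_b1.
have szZ us ws : (size (Z6v x%:P k%:P (map polyC us) ('X :: map polyC ws)) <= size us)%N.
  exact: size_part_poly.
have szB (e : R) : (size (e%:P - 'X)%R <= 2)%N.
  by rewrite -opprB size_polyN size_XsubC.
have szab e : (size (wtab x%:P k%:P e%:P 'X) <= 3)%N.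
  rewrite /wtab; apply: (szM _ _ 1 2)%N; first exact: szB.
  rewrite /wtb -!polyCM -addrA -mulNr -mulrDl -polyCN -polyCD.
  rewrite (leq_trans (size_polyD _ _)) // geq_max size_poly1 /=.
  by rewrite mul_polyC (leq_trans (size_scale_leq _ _)) ?size_polyX.
have szT e f g us ws : size us = (size zs).+1 ->
    (size (wtab x%:P k%:P e%:P 'X * f%:P * Z6v x%:P k%:P (map polyC us) ('X :: map polyC ws) * g%:P)%R
      <= (size zs).+3)%N.
  move=> sus; rewrite -[X in (_ <= X)%N]addn1; apply: (szM); last exact: szC.
  rewrite -addn2 addSn -addnS addnC; apply: (szM _ _ 2); last by rewrite -sus szZ.
  by apply: (szM _ _ 2 1); rewrite ?szab ?szC.
rewrite /condensation_poly (leq_trans (size_polyD _ _)) // geq_max size_polyN; apply/andP; split.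
  rewrite -[X in (_ <= X)%N]addn1; apply: (szM); last exact: szC.
  rewrite -[X in (_ <= X)%N]add1n; apply: (szM); last exact: szZ.
  by apply: (szM _ _ 0 2); rewrite ?szC // size_XsubC.
by rewrite (leq_trans (size_polyD _ _)) // geq_max size_polyN !szT.
Qed.

(** Induction on the number of columns. As a polynomial in [v1], the difference of both sides has
    the size zs + 3 distinct roots [v2], [c], [d] and the members of [zs], more than its degree
    allows. *)
Lemma condensation_small c d zs v1 v2 vs : size zs = size vs ->
  all small (c :: d :: zs) -> all small (v2 :: vs) -> uniq (c :: d :: zs ++ v2 :: vs) ->
  condensation c d zs v1 v2 vs.
Proof.
have [n] := ubnP (size vs); elim: n c d zs v1 v2 vs => // n IHn c d zs v1 v2 vs.
rewrite ltnS => le_n sz_zs /and3P[sc sd]; rewrite -/(all small zs) => szs.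
case/andP=> sv2; rewrite -/(all small vs) => svs uniq_all.
apply/condensation_polyP.
suff -> : condensation_poly c d zs v2 vs = 0 by exact: root0.
apply: (@roots_geq_poly_eq0 _ _ (v2 :: c :: d :: zs)); last first.
- exact: size_condensation_poly.
- move: uniq_all; rewrite -2!cat_cons cat_uniq => /and3P[u1].
  by rewrite [has _ _]/= => /norP[nv2 _] _; rewrite cons_uniq nv2.
apply/allP => z; rewrite inE => /orP[/eqP->|].
  by apply/condensation_polyP; rewrite /condensation; ring.
rewrite inE => /orP[/eqP->|].
  apply/condensation_polyP; rewrite /condensation !Z6v_corner !big_cons /wtab; ring.
rewrite inE => /orP[/eqP->|z_zs].
  have pcd : perm_eq (c :: d :: zs) (d :: c :: zs) by rewrite -[c :: d :: zs]/([:: c] ++ [:: d] ++ zs) perm_catCA.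
  apply/condensation_polyP; rewrite /condensation (@Z6v_perm _ _ _ _ pcd) ?Z6v_corner ?big_cons /wtab /= ?sc ?sd //; ring.
(* At a member [z] of [zs], that row is moved to the front and frozen against the first column; what
   remains is the three-term relation for [c], [d], [z]. *)
have pz := perm_to_rem z_zs; set zs' := rem z zs in pz.
have sz' : all small (z :: zs') by rewrite -(perm_all _ pz).
have perm3 : perm_eq (c :: d :: zs) (z :: c :: d :: zs').
  apply: (perm_trans (y := c :: d :: z :: zs')); first by rewrite !perm_cons.
  by rewrite -[c :: d :: _]/([:: c; d] ++ [:: z] ++ zs') perm_catCA.
have perm2 e : perm_eq (e :: zs) (z :: e :: zs').
  apply: (perm_trans (y := e :: z :: zs')); first by rewrite !perm_cons.
  by rewrite -[e :: _]/([:: e] ++ [:: z] ++ zs') perm_catCA.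
case: vs le_n sz_zs svs uniq_all => [|u us] le_n sz_zs svs uniq_all.
  by move: z_zs; rewrite (size0nil sz_zs).
have sz_zs' : size zs' = size us.
  by move: (perm_size pz); rewrite sz_zs => -[].
have sz'2 : all small zs' by case/andP: sz'.
have U : uniq (z :: c :: d :: zs' ++ v2 :: u :: us).
  have : uniq ((c :: d :: zs) ++ v2 :: u :: us) by [].
  by rewrite (perm_uniq (perm_cat perm3 (perm_refl _))).
have vu : v2 != u.
  by move: U; rewrite -3!cat_cons cat_uniq => /and3P[_ _ /=]; rewrite inE negb_or => /andP[/andP[]].
have {U} : uniq (z :: c :: d :: zs' ++ u :: us).
  have sub : subseq ((z :: c :: d :: zs') ++ u :: us) ((z :: c :: d :: zs') ++ v2 :: u :: us).
    by apply: cat_subseq; [exact: subseq_refl | exact: subseq_cons].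
  exact: subseq_uniq sub U.
rewrite -[z :: _]/([:: z] ++ [:: c; d] ++ _) (perm_uniq (permEl (perm_catCA _ _ _))) => U.
(* This relation follows from condensation over [zs'] and [us], one column fewer, so the induction
   hypothesis applies. *)
have T : three_term c d z zs' v2 (u :: us).
  case/andP: svs => su; rewrite -/(all small us) => sus.
  have sz1 : small z by case/andP: sz'.
  apply: three_term_small => //; last by rewrite /= sc sd sz1.
  by move=> f g w sf sg Ufg; apply: IHn; rewrite //= ?sf ?sg ?su.
apply/condensation_polyP; rewrite /condensation.
rewrite (Z6v_perm _ _ perm3) ?(Z6v_perm _ _ (perm2 _)) ?(Z6v_perm _ _ pz) /= ?sc ?sd ?szs //.
rewrite !Z6v_corner !big_cons.
have swapz e : small e -> Z (z :: e :: zs') (v2 :: u :: us) = Z (e :: z :: zs') (v2 :: u :: us).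
  move=> se; apply: Z6v_perm; first by case/andP: sz' => sz1 _; rewrite /= sz1 se.
  by rewrite -[z :: e :: zs']/([:: z] ++ [:: e] ++ zs') perm_catCA.
move: T; rewrite /three_term !swapz //.
set tt := (X in X = 0 -> _) => T.
apply/eqP; rewrite -subr_eq0; apply/eqP.
transitivity (- (b c z * b d z * \prod_(j <- zs') b j z * (b z u * \prod_(j <- us) b z j)) * tt).
  by rewrite /tt /wtab; ring.
by rewrite T mulr0.
Qed.

End Generic.

Lemma horner_three_term (R : idomainType) (x k t : R) c d e zs v vs :
  three_term x%:P k%:P c d e zs v vs ->
  three_term x k c.[t] d.[t] e.[t] (map (horner_eval t) zs) v.[t] (map (horner_eval t) vs).
Proof.
rewrite /three_term => /(congr1 (horner^~ t)).
rewrite !(hornerD, hornerN, hornerM, horner0) !horner_Z6v /=.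
by rewrite /wtab /wtb !(hornerD, hornerN, hornerM, hornerC) /horner_eval.
Qed.

(** * Passage from small distinct parameters to arbitrary ones *)

Section Perturbation.

Variable F : idomainType.

(* Vanishes at 0 and takes the value c at 1; the size tells apart different i. *)
Definition pert (i : nat) (c : F) : {poly F} := c *: 'X + 'X^(i.+1) * ('X - 1).

Fixpoint pert_seq (i : nat) (s : seq F) : seq {poly F} :=
  if s is c :: s then pert i c :: pert_seq i.+1 s else [::].

Lemma pert_small i c : small (horner_eval (0 : F)) (pert i c).
Proof.
rewrite /small /= /horner_eval /pert !(hornerD, hornerZ, hornerM, hornerXn, hornerX).
by rewrite expr0n /= mul0r mulr0 addr0.
Qed.

Lemma pert1 i c : (pert i c).[1] = c.
Proof.
rewrite /pert !(hornerD, hornerN, hornerZ, hornerM, hornerXn, hornerX, hornerC).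
by rewrite subrr mulr0 addr0 mulr1.
Qed.

Lemma size_pert i c : size (pert i c) = i.+3.
Proof.
have sz : size (('X^(i.+1) * ('X - 1))%R : {poly F}) = i.+3.
  by rewrite size_Mmonic ?monicXsubC ?monic_neq0 ?monicXn // size_polyXn size_XsubC addn2.
rewrite /pert addrC size_polyDl // sz (leq_ltn_trans (size_scale_leq _ _)) //.
by rewrite size_polyX.
Qed.

Lemma pert_seq_small i s : all (small (horner_eval (0 : F))) (pert_seq i s).
Proof. by elim: s i => //= c s IHs i; rewrite pert_small IHs. Qed.

Lemma map_pert_seq i s : map (horner_eval (1 : F)) (pert_seq i s) = s.
Proof. by elim: s i => //= c s IHs i; rewrite IHs /horner_eval pert1. Qed.

Lemma size_pert_seq i s : size (pert_seq i s) = size s.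
Proof. by elim: s i => //= c s IHs i; rewrite IHs. Qed.

Lemma uniq_pert_seq i s : uniq (pert_seq i s).
Proof.
apply: (@map_uniq _ _ (fun p : {poly F} => size p)).
suff -> : [seq size p | p : {poly F} <- pert_seq i s] = iota i.+3 (size s) by exact: iota_uniq.
by elim: s i => //= c s IHs i; rewrite IHs size_pert.
Qed.

Lemma pert_seq_cat i s1 s2 :
  pert_seq i (s1 ++ s2) = pert_seq i s1 ++ pert_seq (i + size s1) s2.
Proof.
elim: s1 i => [|c s1 IHs] i /=; first by rewrite addn0.
by rewrite IHs addSnnS.
Qed.

(** The perturbed rows are small polynomials and may be permuted; evaluation at 1 returns the given
    rows. *)
Lemma perm_Z6v (x k : F) zs zs' ws : perm_eq zs zs' -> Z6v x k zs ws = Z6v x k zs' ws.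
Proof.
move=> pz.
have Zp us : (Z6v x%:P k%:P (map (pert 0) us) (map polyC ws)).[1] = Z6v x k us ws.
  rewrite horner_Z6v map_horner_polyC -map_comp.
  by rewrite (@eq_map _ _ (_ \o _) id) ?map_id // => z; exact: pert1.
rewrite -!Zp; congr (_.[1]).
apply: (@Z6v_perm _ _ (horner_eval (0 : F))); last exact: perm_map.
by apply/allP => p /mapP[z _ ->]; exact: pert_small.
Qed.

(** Perturbed with different indices, the parameters become small and distinct even where the given
    values coincide; evaluation at 1 returns the given relation. *)
Lemma Z6v_three_term (x k c d e v : F) zs vs :
  size vs = (size zs).+1 -> three_term x k c d e zs v vs.
Proof.
case: vs => [|u us] //= [sz].
(* The position of [v] in the concatenated list, hence its perturbation index. *)
pose m := (size zs).+3.
have U := uniq_pert_seq 0 ((c :: d :: e :: zs) ++ v :: u :: us).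
have: three_term x%:P k%:P (pert 0 c) (pert 1 d) (pert 2 e) (pert_seq 3 zs)
   (pert m v) (pert m.+1 u :: pert_seq m.+2 us).
  move: U; rewrite pert_seq_cat /= add0n -/m => U.
  apply: (@three_term_small _ _ (horner_eval (0 : F))).
  - move=> f g w sf sg Ufg; apply: (@condensation_small _ _ (horner_eval (0 : F))) => //.
    + by rewrite !size_pert_seq.
    + by rewrite /= sf sg pert_seq_small.
    + by rewrite /= pert_small pert_seq_small.
  - by rewrite !size_pert_seq.
  - by rewrite /= !pert_small pert_seq_small.
  - exact: pert_seq_small.
  - by apply/eqP => /(congr1 (fun p : {poly F} => size p)); rewrite !size_pert; lia.
  - have sub : subseq ((pert 0 c :: pert 1 d :: pert 2 e :: pert_seq 3 zs) ++ pert m.+1 u :: pert_seq m.+2 us)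
     ((pert 0 c :: pert 1 d :: pert 2 e :: pert_seq 3 zs) ++ pert m v :: pert m.+1 u :: pert_seq m.+2 us).
      by apply: cat_subseq; [exact: subseq_refl | exact: subseq_cons].
    exact: subseq_uniq sub U.
move=> /(horner_three_term 1).
by rewrite /= !map_pert_seq /horner_eval !pert1.
Qed.

End Perturbation.

(** * Rotation of alternating sign matrices *)

Section Rotation.

Variable n : nat.

Definition rot_mx (T : Type) (A : 'M[T]_n) : 'M[T]_n :=
  \matrix_(i, j) A (rev_ord i) (rev_ord j).

Lemma rot_mxK T : involutive (@rot_mx T).
Proof. by move=> A; apply/matrixP => i j; rewrite !mxE !rev_ordK. Qed.

Lemma map_rev_ord_enum : [seq rev_ord i | i <- enum 'I_n] = rev (enum 'I_n).
Proof.
apply: (inj_map val_inj); rewrite map_rev val_enum_ord -map_comp.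
rewrite (eq_map (g := fun i : 'I_n => n - i.+1)%N) // (map_comp (fun k => n - k.+1)%N val) val_enum_ord.
apply: (@eq_from_nth _ 0%N); rewrite size_map ?size_rev ?size_iota // => i lt_in.
by rewrite (nth_map 0%N) ?size_iota // nth_rev ?size_iota // !nth_iota //; lia.
Qed.

Lemma asm_line_rev s : asm_line (rev s) = asm_line s.
Proof.
rewrite /asm_line /alternating filter_rev rev_sorted; congr (_ && _).
  by apply: eq_sorted => a b; rewrite mulrC.
by congr (_ == _); apply: perm_big; rewrite perm_rev.
Qed.

Lemma forall_rev_ord (P : pred 'I_n) : [forall i, P (rev_ord i)] = [forall i, P i].
Proof. by apply/forallP/forallP => H i; [rewrite -(rev_ordK i) | ]; apply: H. Qed.

Lemma exists_rev_ord (P : pred 'I_n) : [exists i, P (rev_ord i)] = [exists i, P i].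
Proof.
by apply/existsP/existsP => -[i Pi]; exists (rev_ord i); rewrite ?rev_ordK.
Qed.

Lemma is_asm_rot (A : 'M[int]_n) : is_asm (rot_mx A) = is_asm A.
Proof.
have rowE (F : 'I_n -> int) :
    asm_line [seq F (rev_ord j) | j <- enum 'I_n] = asm_line [seq F j | j <- enum 'I_n].
  by rewrite (map_comp F (@rev_ord n)) map_rev_ord_enum map_rev asm_line_rev.
rewrite /is_asm; congr (_ && _); last congr (_ && _).
- rewrite -[RHS]forall_rev_ord; apply: eq_forallb => i.
  by rewrite -[RHS]forall_rev_ord; apply: eq_forallb => j; rewrite mxE.
- rewrite -[RHS]forall_rev_ord; apply: eq_forallb => i.
  by rewrite -[RHS]rowE; congr asm_line; apply: eq_map => j; rewrite mxE.
- rewrite -[RHS]forall_rev_ord; apply: eq_forallb => i.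
  by rewrite -[RHS]rowE; congr asm_line; apply: eq_map => j; rewrite mxE.
Qed.

(** The half turn sends a pair of cells counted by [nuz] to such a pair in the opposite order. *)
Lemma nuz_rot (A : 'M[int]_n) : nuz (rot_mx A) = nuz A.
Proof.
rewrite /nuz (exchange_big_dep xpredT) //= (reindex_inj rev_ord_inj); apply: eq_bigr => i _.
rewrite (reindex_inj rev_ord_inj); apply: eq_big => [i'|i' _].
  by rewrite /=; have := ltn_ord i; have := ltn_ord i'; lia.
rewrite (exchange_big_dep xpredT) //= (reindex_inj rev_ord_inj); apply: eq_bigr => j _.
rewrite (reindex_inj rev_ord_inj); apply: eq_big => [j'|j' _].
  by rewrite /=; have := ltn_ord j; have := ltn_ord j'; lia.
by rewrite !mxE !rev_ordK mulrC.
Qed.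

Lemma card_set_rev_ord (P Q : pred 'I_n) : (forall i, Q i = P (rev_ord i)) ->
  #|[set i | Q i]| = #|[set i | P i]|.
Proof.
move=> QP; rewrite -(card_imset _ (@rev_ord_inj n)); congr #|pred_of_set _|.
apply/setP => i; rewrite inE; apply/imsetP/idP => [[j]|Pi].
  by rewrite inE QP => Pj ->.
by exists (rev_ord i); rewrite ?rev_ordK // inE QP rev_ordK.
Qed.

Lemma mu_rot (A : 'M[int]_n) : mu (rot_mx A) = mu A.
Proof.
pose f (p : 'I_n * 'I_n) := (rev_ord p.1, rev_ord p.2).
have fK : involutive f by move=> [i j]; rewrite /f /= !rev_ordK.
rewrite /mu -(card_imset _ (inv_inj fK)); congr #|pred_of_set _|.
apply/setP => p; rewrite inE; apply/imsetP/idP => [[q]|Ap].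
  by rewrite inE mxE => Aq ->.
by exists (f p); rewrite ?fK // inE mxE !rev_ordK.
Qed.

Lemma rhoT_rot (A : 'M[int]_n) : rhoT (rot_mx A) = rhoB A.
Proof.
apply: card_set_rev_ord => j; rewrite -[RHS]exists_rev_ord; apply: eq_existsb => i.
rewrite -[RHS]exists_rev_ord; apply: eq_existsb => j'; rewrite !mxE /=.
congr (_ && (_ && (_ && _))); have := ltn_ord i; have := ltn_ord j; have := ltn_ord j'; lia.
Qed.

Lemma rhoR_rot (A : 'M[int]_n) : rhoR (rot_mx A) = rhoL A.
Proof.
apply: card_set_rev_ord => j; rewrite -[RHS]exists_rev_ord; apply: eq_existsb => i.
rewrite -[RHS]exists_rev_ord; apply: eq_existsb => j'; rewrite !mxE /=.
congr (_ && (_ && (_ && _))); have := ltn_ord i; have := ltn_ord j; have := ltn_ord j'; lia.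
Qed.

Lemma int_mx_rot (A : 'M[asm_entry]_n) : int_mx (rot_mx A) = rot_mx (int_mx A).
Proof. by apply/matrixP => i j; rewrite !mxE. Qed.

End Rotation.

(** Turns [Zadjt] into a case of [Ztri], so that the right-most column never has to be weighted. *)
Lemma Zquad_rot (R : comNzRingType) n (x y z1 z2 z3 z4 : R) :
  Zquad n x y z1 z2 z3 z4 = Zquad n x y z3 z4 z1 z2.
Proof.
rewrite /Zquad (reindex_inj (inv_inj (@rot_mxK n asm_entry))) /=.
apply: eq_big => [A|A _]; first by rewrite !inE int_mx_rot is_asm_rot.
rewrite int_mx_rot /nu nuz_rot mu_rot rhoT_rot rhoR_rot.
(* The statistics [rhoB] and [rhoL] of the rotated matrix are [rhoT] and [rhoR] after a second half
   turn, which restores the matrix. *)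
rewrite -(rhoT_rot (rot_mx (int_mx A))) -(rhoR_rot (rot_mx (int_mx A))) rot_mxK.
by rewrite -!mulrA; congr (_ * (_ * _)); rewrite mulrA [RHS]mulrA mulrC.
Qed.

(** * Alternating sign matrices as lattice configurations *)

Lemma mem_words (T : eqType) (E : seq T) n w :
  (w \in words E n) = (size w == n) && all (mem E) w.
Proof.
elim: n w => [|n IHn] w; first by rewrite inE; case: w.
case: w => [|a w] /=.
  by apply/negP => /allpairsP[[b v] [_ _]].
rewrite eqSS; apply/allpairsP/idP => [[[b v] /= [Eb]]|/and3P[sw Ea Ew]].
  by rewrite IHn => /andP[sv Ev] [-> ->]; rewrite sv /= Eb.
by exists (a, w); split; rewrite //= IHn sw.
Qed.

Lemma uniq_words (T : eqType) (E : seq T) n : uniq E -> uniq (words E n).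
Proof.
move=> uE; elim: n => [|n IHn] //.
by apply: allpairs_uniq => // -[a v] [b w] _ _ /= [-> ->].
Qed.

Definition entries : seq int := [:: 0; 1; -1].

Definition bit (a : int) : bool := (a == 0) || (a == 1).

Section IntStates.

Variables (R : comNzRingType) (A B : Type).
Variable L : A -> B -> bool -> bool -> bool -> bool -> R.

Hypothesis ice : forall a b (h v h' v' : bool),
  (h + v' != h' + v)%N -> L a b h v h' v' = 0.

(* e is the matrix entry at the vertex: h + e and v + e are the right and bottom
   edges. *)
Definition intw r c (h v e : int) : R :=
  if [&& bit h, bit v, bit (h + e) & bit (v + e)]
  then L r c (h == 1) (v == 1) (h + e == 1) (v + e == 1) else 0.

Definition addz (s w : seq int) := [seq p.1 + p.2 | p <- zip s w].

Definition bitsz (s : seq bool) : seq int := [seq (b : nat)%:Z | b : bool <- s].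

Fixpoint row_weight r (cs : seq B) (h : int) (s w : seq int) : R :=
  match cs, s, w with
  | [::], [::], [::] => (h == 1)%:R
  | c :: cs, v :: s, e :: w => intw r c h v e * row_weight r cs (h + e) s w
  | _, _, _ => 0
  end.

Fixpoint mx_weight rs cs (s : seq int) (M : seq (seq int)) : R :=
  match rs, M with
  | [::], [::] => (all (pred1 1) s)%:R
  | r :: rs, w :: M => row_weight r cs 0 s w * mx_weight rs cs (addz s w) M
  | _, _ => 0
  end.

(** By the ice rule one entry e = h' - h = v' - v determines both new edges, and [intw] vanishes
    when an edge leaves 0 and 1. The arbitrary [F] stands for the rows below. *)
Lemma transfer_words r cs (h : bool) s (F : seq int -> R) : size s = size cs ->
  \sum_(t <- words bits (size cs)) transfer L r cs h true s t * F (bitsz t) =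
  \sum_(w <- words entries (size cs))
     row_weight r cs (h : nat)%:Z (bitsz s) w * F (addz (bitsz s) w).
Proof.
elim: cs h s F => [|c cs IHcs] h [|v s] F //=.
  by rewrite !big_words0; case: h.
move=> [ss]; rewrite !big_words big_bits /entries !big_cons big_nil addr0 /=.
have IH (h' b : bool) e : (b : nat)%:Z = (v : nat)%:Z + e ->
    \sum_(t <- words bits (size cs)) transfer L r cs h' true s t * F ((b : nat)%:Z :: bitsz t) =
    \sum_(w <- words entries (size cs)) row_weight r cs (h' : nat)%:Z (bitsz s) w *
       F (((v : nat)%:Z + e) :: addz (bitsz s) w).
  by move=> <-; exact: (IHcs h' s (fun u => F ((b : nat)%:Z :: u)) ss).
have split (b : bool) :
    \sum_(t <- words bits (size cs)) (\sum_(h' <- bits) L r c h v h' b * transfer L r cs h' true s t) *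
       F (bitsz (b :: t)) =
    \sum_(h' <- bits) L r c h v h' b *
       \sum_(t <- words bits (size cs)) transfer L r cs h' true s t * F ((b : nat)%:Z :: bitsz t).
  rewrite !big_bits !mulr_sumr -big_split /=; apply: eq_bigr => t _.
  by rewrite big_bits; ring.
rewrite !split !big_bits.
have pull e : \sum_(w <- words entries (size cs))
      intw r c (h : nat)%:Z (v : nat)%:Z e * row_weight r cs ((h : nat)%:Z + e) (bitsz s) w *
        F (addz (bitsz (v :: s)) (e :: w)) =
    intw r c (h : nat)%:Z (v : nat)%:Z e * \sum_(w <- words entries (size cs))
      row_weight r cs ((h : nat)%:Z + e) (bitsz s) w * F (((v : nat)%:Z + e) :: addz (bitsz s) w).
  by rewrite mulr_sumr; apply: eq_bigr => w _; rewrite mulrA.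
rewrite !pull /intw.
have ice0 (h' v' : bool) : (h + v' != h' + v)%N -> L r c h v h' v' = 0 by exact: ice.
case: h v ice0 IH {split pull ss} => -[] ice0 IH.
- rewrite (ice0 true false) // (ice0 false true) // !mul0r addr0 add0r.
  by rewrite (IH true true 0) // (IH false false (-1)) // /= add0r.
- rewrite (ice0 true true) // (ice0 false true) // (ice0 false false) // !mul0r !add0r !addr0.
  by rewrite (IH true false 0) // /= ?(mul0r, addr0, add0r).
- rewrite (ice0 true true) // (ice0 true false) // (ice0 false false) // !mul0r !add0r !addr0.
  by rewrite (IH false true 0) // /= ?(mul0r, addr0, add0r).
- rewrite (ice0 true false) // (ice0 false true) // !mul0r addr0 add0r.
  by rewrite (IH true true 1) // (IH false false 0) // addrC /= ?(mul0r, addr0, add0r).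
Qed.

(** The sum now runs over all arrays with entries 0, 1, -1; [mx_weight_rows_of] shows that those
    which are not ASMs contribute 0. *)
Lemma part_words rs cs s : size s = size cs ->
  part L rs cs s =
  \sum_(M <- words (words entries (size cs)) (size rs)) mx_weight rs cs (bitsz s) M.
Proof.
elim: rs s => [|r rs IHrs] s ss.
  rewrite big_words0 /= all_map; congr (nat_of_bool _)%:R.
  by apply: eq_all => -[].
rewrite big_words; transitivity (\sum_(t <- words bits (size cs)) transfer L r cs false true s t *
    \sum_(M <- words (words entries (size cs)) (size rs)) mx_weight rs cs (bitsz t) M).
  rewrite [LHS]/=; apply: eq_big_words => t st;  by rewrite IHrs.
rewrite (transfer_words _ _ (fun u => \sum_(M <- _) mx_weight rs cs u M)) //.
by apply: eq_bigr => w _; rewrite mulr_sumr.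
Qed.

Lemma row_weightE c0 r cs h s w : size s = size cs -> size w = size cs ->
  row_weight r cs h s w =
  \prod_(j < size cs) intw r (nth c0 cs j) (h + \sum_(j' < j) nth 0 w j') (nth 0 s j) (nth 0 w j)
  * (h + \sum_(j < size cs) nth 0 w j == 1)%:R.
Proof.
elim: cs h s w => [|c cs IHcs] h [|v s] [|e w] //=; first by rewrite !big_ord0 addr0 mul1r.
move=> [ss] [sw]; rewrite big_ord_recl /= big_ord0 addr0 -mulrA; congr (_ * _).
rewrite IHcs // big_ord_recl /= addrA; congr (_ * _).
by apply: eq_bigr => j _; rewrite big_ord_recl /= addrA.
Qed.

Lemma mx_weightE r0 c0 rs cs s M :
  size s = size cs -> size M = size rs -> all (fun w => size w == size cs) M ->
  mx_weight rs cs s M =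
  \prod_(i < size rs)
   (\prod_(j < size cs)
       intw (nth r0 rs i) (nth c0 cs j) (\sum_(j' < j) nth 0 (nth [::] M i) j')
         (nth 0 s j + \sum_(i' < i) nth 0 (nth [::] M i') j) (nth 0 (nth [::] M i) j)
    * (\sum_(j < size cs) nth 0 (nth [::] M i) j == 1)%:R)
  * \prod_(j < size cs) (nth 0 s j + \sum_(i < size rs) nth 0 (nth [::] M i) j == 1)%:R.
Proof.
elim: rs s M => [|r rs IHrs] s [|w M] //= ss.
  move=> _ _; rewrite big_ord0 mul1r.
  under eq_bigr do rewrite big_ord0 addr0.
  elim: cs s ss => [|c cs IHcs] [|v s] //=; first by rewrite big_ord0.
  move=> [ss]; rewrite big_ord_recl /= -IHcs //.
  by case: (v == 1); rewrite ?mul1r ?mul0r.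
move=> [sM] /andP[/eqP sw sMs]; rewrite big_ord_recl /= -mulrA.
have nth_addz j : (j < size cs)%N -> nth 0 (addz s w) j = nth 0 s j + nth 0 w j.
  move=> lt_j; rewrite (nth_map (0, 0)) ?size_zip ?ss ?sw ?minnn //.
  by rewrite nth_zip ?ss ?sw.
have sz : size (addz s w) = size cs by rewrite size_map size_zip ss sw minnn.
rewrite (row_weightE c0) // add0r IHrs //; congr (_ * _).
  congr (_ * _); apply: eq_bigr => j _; by rewrite big_ord0 addr0 add0r.
congr (_ * _).
  apply: eq_bigr => i _; congr (_ * _); apply: eq_bigr => j _.
  by rewrite [in RHS]big_ord_recl /= nth_addz // addrA.
by apply: eq_bigr => j _; rewrite [in RHS]big_ord_recl /= nth_addz // addrA.
Qed.

End IntStates.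

Fixpoint bit_path (h : int) (s : seq int) : bool :=
  bit h && (if s is e :: s then bit_path (h + e) s else h == 1).

Lemma bit_pathP h s :
  reflect ((forall k, bit (h + \sum_(a <- take k s) a)) /\ h + \sum_(a <- s) a = 1)
          (bit_path h s).
Proof.
elim: s h => [|e s IHs] h /=.
  apply: (iffP andP) => [[bh /eqP h1]|[bh h1]].
    by split=> [k|]; rewrite big_nil addr0.
  by move: (bh 0%N) h1; rewrite !big_nil addr0 => -> ->.
apply: (iffP andP) => [[bh /IHs[bs h1]]|[bs h1]].
  split=> [[|k]|]; rewrite ?big_nil ?addr0 //=; first by rewrite big_cons addrA.
  by rewrite big_cons addrA.
split; first by move: (bs 0%N); rewrite big_nil addr0.
move: h1; rewrite big_cons addrA => h1; apply/IHs; split=> // k.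
by move: (bs k.+1); rewrite /= big_cons addrA.
Qed.

(** The partial sum [h] remembers the last nonzero entry: 1 if on, -1 if off. The next nonzero entry
    keeps the sum in {0, 1} exactly when its sign is opposite. *)
Lemma bit_path_alt (h : bool) s : all (mem entries) s ->
  bit_path (h : nat)%:Z s =
  path (fun a b => a * b < 0) (if h then 1 else -1) [seq a <- s | a != 0]
  && ((h : nat)%:Z + \sum_(a <- s) a == 1).
Proof.
elim: s h => [|e s IHs] h /=; first by rewrite big_nil addr0; case: h.
case/andP => Ee /IHs{}IHs.
rewrite big_cons addrA.
have bh : bit (h : nat)%:Z by case: h.
rewrite bh /=.
move: Ee; rewrite !inE => /or3P[] /eqP->.
- by rewrite addr0 IHs.
- by case: h {bh}; [case: s {IHs} | exact: (IHs true)].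
- by case: h {bh}; [exact: (IHs false) | case: s {IHs}].
Qed.

Lemma alt_sum (h : bool) s : all (mem entries) s ->
  path (fun a b => a * b < 0) (if h then 1 else -1) [seq a <- s | a != 0] ->
  bit ((h : nat)%:Z + \sum_(a <- s) a).
Proof.
elim: s h => [|e s IHs] h /=; first by rewrite big_nil addr0; case: h.
case/andP => Ee /IHs{}IHs.
rewrite big_cons addrA.
move: Ee; rewrite !inE => /or3P[] /eqP->.
- by rewrite addr0; apply: IHs.
- by case: h => //=; exact: (IHs true).
- by case: h => //=; exact: (IHs false).
Qed.

(** [bit_path_alt] started with [h] off also asks that the first nonzero entry be 1; this follows
    from alternation and sum 1. *)
Lemma asm_line_bit_path s : all (mem entries) s -> asm_line s = bit_path 0 s.
Proof.
move=> Es; rewrite (bit_path_alt false Es) add0r /asm_line /alternating.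
apply: andb_id2r => /eqP s1.
elim: s Es s1 => [|e s IHs] //= /andP[Ee Es]; rewrite big_cons.
move: Ee; rewrite !inE => /or3P[] /eqP->.
- by rewrite add0r; apply: IHs.
- by [].
(* If the first nonzero entry is -1, the later ones must sum to 2; but they alternate starting with
   1, so they sum to 0 or 1. *)
move=> s1; apply/negbTE/negP => Hp.
have := alt_sum (h := false) Es Hp.
by rewrite add0r -(addKr (-1) (\sum_(a <- s) a)) s1 opprK.
Qed.

Section Matrices.

Variable n : nat.

Definition rows_of (A : 'M[int]_n) := [seq [seq A i j | j <- enum 'I_n] | i <- enum 'I_n].

(** [hpart A i j] is the edge to the left of the cell (i, j), and [vpart A i j] the edge above
    it. *)
Definition hpart (A : 'M[int]_n) (i : 'I_n) (k : nat) : int := \sum_(j < n | (j < k)%N) A i j.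
Definition vpart (A : 'M[int]_n) (k : nat) (j : 'I_n) : int := \sum_(i < n | (i < k)%N) A i j.

Lemma big_enum_take (w : 'I_n -> int) k :
  \sum_(a <- take k [seq w j | j <- enum 'I_n]) a = \sum_(j < n | (j < k)%N) w j.
Proof.
rewrite -map_take big_map.
have -> : take k (enum 'I_n) = [seq j : 'I_n <- enum 'I_n | (j < k)%N].
  apply: (inj_map val_inj); rewrite map_take val_enum_ord.
  rewrite -(filter_map val (fun i => i < k)%N) val_enum_ord.
  rewrite take_iota.
  have [le_kn|/ltnW le_nk] := leqP k n.
    rewrite -[in RHS](subnKC le_kn) iotaD filter_cat.
    rewrite (all_filterP _); last by apply/allP => i; rewrite mem_iota.
    rewrite (eq_in_filter (a2 := pred0)) ?filter_pred0 ?cats0 //.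
    by move=> i; rewrite mem_iota add0n => /andP[? _]; apply/negbTE; rewrite -leqNgt.
  rewrite (all_filterP _) //; apply/allP => i; rewrite mem_iota => /andP[_ lt_i].
  exact: leq_trans lt_i le_nk.
by rewrite big_filter big_enum_cond.
Qed.

Lemma hpartS A i (j : 'I_n) : hpart A i j.+1 = hpart A i j + A i j.
Proof.
rewrite /hpart (bigD1 j) //= addrC; congr (_ + _).
by apply: eq_bigl => j'; rewrite ltnS ltn_neqAle andbC.
Qed.

Lemma vpartS A (i : 'I_n) j : vpart A i.+1 j = vpart A i j + A i j.
Proof.
rewrite /vpart (bigD1 i) //= addrC; congr (_ + _).
by apply: eq_bigl => i'; rewrite ltnS ltn_neqAle andbC.
Qed.

Lemma hpart_tr A i k : hpart A^T i k = vpart A k i.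
Proof. by apply: eq_bigr => j _; rewrite mxE. Qed.

Lemma is_asmP (A : 'M[int]_n) : (forall i j, A i j \in entries) ->
  reflect ([/\ forall i k, bit (hpart A i k), forall i, \sum_j A i j = 1,
               forall k j, bit (vpart A k j) & forall j, \sum_i A i j = 1])
          (is_asm A).
Proof.
move=> EA; rewrite /is_asm.
have lineP (w : 'I_n -> int) : (forall j, w j \in entries) ->
    reflect ((forall k, bit (\sum_(j < n | (j < k)%N) w j)) /\ \sum_j w j = 1)
      (asm_line [seq w j | j <- enum 'I_n]).
  move=> Ew; rewrite asm_line_bit_path; last by apply/allP => _ /mapP[j _ ->]; exact: Ew.
  apply: (iffP (bit_pathP _ _)); rewrite add0r big_map big_enum.
    by move=> [bw ->]; split=> // k; rewrite -big_enum_take -[X in bit X]add0r.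
  by move=> [bw ->]; split=> // k; rewrite add0r big_enum_take.
have rP i := lineP _ (EA i).
have cP j := lineP (fun i => A i j) (fun i => EA i j).
apply: (iffP and3P) => [[_ /forallP rowA /forallP colA]|[rb rs cb cs]].
  split=> [i k|i|k j|j].
  - by have /rP[bA _] := rowA i; exact: bA.
  - by have /rP[] := rowA i.
  - by have /cP[bA _] := colA j; exact: bA.
  - by have /cP[] := colA j.
split; first by apply/'forall_forallP => i j; exact: EA.
- by apply/forallP => i; apply/rP; split=> [k|]; [exact: rb | exact: rs].
- by apply/forallP => j; apply/cP; split=> [k|]; [exact: cb | exact: cs].
Qed.

Lemma nth_rows_of A (i j : 'I_n) : nth 0 (nth [::] (rows_of A) i) j = A i j.
Proof. by rewrite (nth_map i) ?size_enum_ord // (nth_map j) ?size_enum_ord // !nth_ord_enum. Qed.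

Lemma size_rows_of A : size (rows_of A) = n.
Proof. by rewrite size_map size_enum_ord. Qed.

Variables (R : idomainType) (L : nat -> nat -> bool -> bool -> bool -> bool -> R).
Hypothesis ice : forall a b (h v h' v' : bool),
  (h + v' != h' + v)%N -> L a b h v h' v' = 0.

Definition state_prod (A : 'M[int]_n) : R :=
  \prod_(i < n) \prod_(j < n) L i j (hpart A i j == 1) (vpart A i j == 1)
                        (hpart A i j.+1 == 1) (vpart A i.+1 j == 1).

(** In an integral domain a nonzero weight has nonzero factors: all edges are then bits and all rows
    and columns sum to 1, which is the criterion [is_asmP]. *)
Lemma mx_weight_rows_of (A : 'M[int]_n) : (forall i j, A i j \in entries) ->
  mx_weight L (iota 0 n) (iota 0 n) (nseq n 0) (rows_of A) =
  if is_asm A then state_prod A else 0.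
Proof.
move=> EA.
rewrite (mx_weightE L 0%N 0%N) ?size_nseq ?size_iota ?size_rows_of //; last first.
  by apply/allP => _ /mapP[i _ ->]; rewrite size_map size_enum_ord.
have hE (i : 'I_n) k : (k <= n)%N -> \sum_(j' < k) nth 0 (nth [::] (rows_of A) i) j' = hpart A i k.
  move=> le_kn; rewrite (big_ord_widen _ (nth 0 (nth [::] (rows_of A) i)) le_kn).
  by apply: eq_bigr => j _; rewrite nth_rows_of.
have vE (j : 'I_n) k : (k <= n)%N -> \sum_(i' < k) nth 0 (nth [::] (rows_of A) i') j = vpart A k j.
  move=> le_kn; rewrite (big_ord_widen _ (fun i' => nth 0 (nth [::] (rows_of A) i') j) le_kn).
  by apply: eq_bigr => i _; rewrite nth_rows_of.
set rhs := RHS.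
have -> : \prod_(j < n) ((nseq n (0:int))`_j + \sum_(i < n) nth 0 (nth [::] (rows_of A) i) j == 1)%:R
    = \prod_(j < n) (\sum_i A i j == 1)%:R :> R.
  apply: eq_bigr => j _; rewrite nth_nseq ltn_ord add0r.
  by congr (_ == _)%:R; apply: eq_bigr => i _; rewrite nth_rows_of.
under eq_bigr => i _.
  under eq_bigr => j _.
    rewrite !nth_iota // !add0n nth_nseq ltn_ord add0r hE 1?ltnW // vE 1?ltnW // nth_rows_of.
    over.
  under [X in X == 1]eq_bigr do rewrite nth_rows_of.
  over.
rewrite big_split /=.
rewrite /rhs; case: (is_asmP EA) => [[rb rs cb cs]|Nasm].
  rewrite [X in _ * X * _]big1 ?mulr1; last by move=> i _; rewrite rs eqxx.
  rewrite [X in _ * X]big1 ?mulr1; last by move=> j _; rewrite cs eqxx.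
  apply: eq_bigr => i _; apply: eq_bigr => j _.
  by rewrite /intw -hpartS -vpartS !rb !cb.
apply/eqP/contraT; rewrite !mulf_eq0 !negb_or -!andbA => /and3P[NW Nr Nc].
exfalso; apply: Nasm.
have rs i : \sum_j A i j = 1.
  by move/prodf_neq0/(_ i isT): Nr; case: (\sum_j A i j =P 1) => // _; rewrite eqxx.
have cs j : \sum_i A i j = 1.
  by move/prodf_neq0/(_ j isT): Nc; case: (\sum_i A i j =P 1) => // _; rewrite eqxx.
have W (i j : 'I_n) : intw L i j (hpart A i j) (vpart A i j) (A i j) != 0.
  by move/prodf_neq0/(_ i isT)/prodf_neq0/(_ j isT): NW.
have bW (i j : 'I_n) : bit (hpart A i j) /\ bit (vpart A i j).
  by move: (W i j); rewrite /intw; case: and4P => [[]|]; rewrite ?eqxx.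
split=> // [i k|k j].
  (* From k = n on, the partial sum is the whole row sum 1. *)
  have [lt_kn|le_nk] := ltnP k n; first by have [] := bW i (Ordinal lt_kn).
  rewrite /hpart (eq_bigl xpredT) ?rs // => j.
  by rewrite (leq_trans (ltn_ord j) le_nk).
have [lt_kn|le_nk] := ltnP k n; first by have [] := bW (Ordinal lt_kn) j.
rewrite /vpart (eq_bigl xpredT) ?cs // => i.
by rewrite (leq_trans (ltn_ord i) le_nk).
Qed.

Lemma int_mx_entries (A : 'M[asm_entry]_n) i j : int_mx A i j \in entries.
Proof. by rewrite mxE; exact: ssvalP. Qed.

(** [rows_of] matches the matrices over [asm_entry] bijectively with the n-by-n arrays summed over
    in [part_words]. *)
Lemma dwbc_asm :
  dwbc L (iota 0 n) (iota 0 n) = \sum_(A in ASM n) state_prod (int_mx A).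
Proof.
rewrite /dwbc (part_words ice) ?size_nseq // !size_iota.
have -> : bitsz (nseq n false) = nseq n 0 by rewrite /bitsz map_nseq.
transitivity (\sum_(A : 'M[asm_entry]_n)
    mx_weight L (iota 0 n) (iota 0 n) (nseq n 0) (rows_of (int_mx A))); last first.
  rewrite [RHS]big_mkcond; apply: eq_bigr => A _ /=.
  by rewrite inE mx_weight_rows_of //; exact: int_mx_entries.
rewrite -(big_map (fun A : 'M[asm_entry]_n => rows_of (int_mx A)) xpredT
            (mx_weight L (iota 0 n) (iota 0 n) (nseq n 0))).
apply: perm_big; apply: uniq_perm.
- by do 2!apply: uniq_words.
- rewrite map_inj_uniq ?index_enum_uniq // => A B AB.
  apply/matrixP => i j; apply: val_inj.
  have := congr1 (fun M => nth 0 (nth [::] M i) j) AB.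
  by rewrite /= !nth_rows_of !mxE.
move=> M; rewrite mem_words; apply/andP/mapP => [[/eqP sM /allP EM]|[A _ ->]].
  (* [e0] is only the default of [insubd]: the entries of [M] all lie in [entries]. *)
  have e0P : (0 : int) \in [:: 0; 1; -1 : int] by [].
  pose e0 : asm_entry := SeqSub e0P.
  exists (\matrix_(i, j) insubd e0 (nth 0 (nth [::] M i) j)); first exact: mem_index_enum.
  have EMi i : (i < n)%N -> nth [::] M i \in words entries n.
    by move=> lt_in; apply: EM; rewrite mem_nth ?sM.
  have sMi i : (i < n)%N -> size (nth [::] M i) = n.
    by move=> /EMi; rewrite mem_words => /andP[/eqP].
  apply: (@eq_from_nth _ [::]); rewrite ?size_rows_of // => i; rewrite sM => lt_in.
  apply: (@eq_from_nth _ 0).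
    by rewrite sMi // (nth_map (Ordinal lt_in)) ?size_enum_ord // size_map size_enum_ord.
  rewrite sMi // => j lt_jn.
  rewrite (nth_rows_of _ (Ordinal lt_in) (Ordinal lt_jn)) !mxE /=.
  have : nth 0 (nth [::] M i) j \in entries.
    by have := EMi i lt_in; rewrite mem_words => /andP[_ /allP]; apply; rewrite mem_nth ?sMi.
  by move=> Ee; rewrite -[LHS](insubdK e0 Ee).
rewrite size_rows_of eqxx; split=> //; apply/allP => w /mapP[i _ ->].
change (is_true ([seq int_mx A i j | j <- enum 'I_n] \in words entries n)).
rewrite mem_words size_map size_enum_ord eqxx.
by apply/allP => _ /mapP[j _ ->]; exact: int_mx_entries.
Qed.

End Matrices.

(** A 0-1 vector of sum 1 has a single 1, so a partial sum detects whether it lies in [P]. *)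
Lemma bit_sum_pick (n : nat) (w : 'I_n -> int) (P : pred 'I_n) :
  (forall j, bit (w j)) -> \sum_j w j = 1 ->
  [exists j, (w j == 1) && P j] = (\sum_(j | P j) w j == 1).
Proof.
move=> bw w1; have w0 j : 0 <= w j by case/orP: (bw j) => /eqP->.
have le1 : \sum_(j | P j) w j <= 1.
  by rewrite -w1 [leRHS](bigID P) /= lerDl sumr_ge0.
apply/existsP/eqP => [[j /andP[/eqP wj Pj]]|sP].
  apply/le_anti; rewrite le1 /= (bigD1 j) //= wj lerDl sumr_ge0 //.
apply/existsP/contraT; rewrite negb_exists => /forallP Nw.
suff : \sum_(j | P j) w j = 0 by rewrite sP.
apply: big1 => j Pj; move: (Nw j) (bw j); rewrite Pj andbT /bit.
by case: (w j == 1) => // _; rewrite orbF => /eqP.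
Qed.

Lemma sum_pick (n : nat) (i0 : 'I_n) (P : pred 'I_n) (Q : pred 'I_n) : Q =1 pred1 i0 ->
  (\sum_i (Q i && P i : nat))%N = P i0.
Proof.
move=> Qi0; rewrite (bigD1 i0) //= Qi0 /= eqxx big1 ?addn0 // => i /negPf.
by rewrite Qi0 /= => ->.
Qed.

Lemma card_set_sum (T : finType) (P : pred T) : #|[set t | P t]| = (\sum_t P t)%N.
Proof. by rewrite -sum1_card big_mkcond; apply: eq_bigr => t _; rewrite inE; case: (P t). Qed.

(** * The statistics as numbers of vertices of given types *)

Section Statistics.

Variable n : nat.

Definition asm_bits (A : 'M[int]_n) := 
  [/\ forall i k, bit (hpart A i k), forall i, \sum_j A i j = 1,
      forall k j, bit (vpart A k j) & forall j, \sum_i A i j = 1].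

Definition all_off (A : 'M[int]_n) (i j : 'I_n) :=
  [&& hpart A i j != 1, vpart A i j != 1, hpart A i j.+1 != 1 & vpart A i.+1 j != 1].

Definition all_on (A : 'M[int]_n) (i j : 'I_n) :=
  [&& hpart A i j == 1, vpart A i j == 1, hpart A i j.+1 == 1 & vpart A i.+1 j == 1].

Definition drop_off (A : 'M[int]_n) (i j : 'I_n) :=
  [&& hpart A i j == 1, vpart A i j == 1, hpart A i j.+1 != 1 & vpart A i.+1 j != 1].

Lemma vpart_tr (A : 'M[int]_n) k i : vpart A^T k i = hpart A i k.
Proof. by apply: eq_bigr => j _; rewrite mxE. Qed.

Lemma asm_bits_tr A : asm_bits A -> asm_bits A^T.
Proof.
move=> [rb rs cb cs]; split=> [i k|i|k j|j].
- by rewrite hpart_tr.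
- by rewrite -(cs i); apply: eq_bigr => j _; rewrite mxE.
- by rewrite vpart_tr.
- by rewrite -(rs j); apply: eq_bigr => i _; rewrite mxE.
Qed.

Lemma all_off_tr A i j : all_off A^T i j = all_off A j i.
Proof.
rewrite /all_off !hpart_tr !vpart_tr.
by case: (_ == _); case: (_ == _); case: (_ == _); case: (_ == _).
Qed.

Lemma vpart0 (A : 'M[int]_n) j : vpart A 0 j = 0.
Proof. by apply: big1 => i. Qed.

Lemma hpart0 (A : 'M[int]_n) i : hpart A i 0 = 0.
Proof. by apply: big1 => i'. Qed.

Lemma vpart_full (A : 'M[int]_n) j : vpart A n j = \sum_i A i j.
Proof. by apply: eq_bigl => i; rewrite ltn_ord. Qed.

(** The edges above the top row are off. A zero there lies before the 1 exactly when its horizontal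
    edges are off too, so the vertex is all off. *)
Lemma rhoT_sum A : asm_bits A ->
  rhoT A = (\sum_(i < n) \sum_(j < n) ((i == 0%N :> nat) && all_off A i j : nat))%N.
Proof.
move=> [rb rs cb cs]; rewrite exchange_big /rhoT card_set_sum; apply: eq_bigr => j _.
have n0 : (0 < n)%N by exact: leq_trans (ltn_ord j).
have Q0 : (fun i : 'I_n => i == 0%N :> nat) =1 pred1 (Ordinal n0) by [].
set i0 := Ordinal n0 in Q0; rewrite (sum_pick _ Q0); congr nat_of_bool.
transitivity ((A i0 j == 0) && [exists j', (A i0 j' == 1) && (j < j')%N]).
  apply/existsP/andP => [[i /existsP[j' /and4P[i0i A1 lt A0]]]|[A0 /existsP[j' /andP[A1 lt]]]].
    have ii0 : i = i0 by apply/eqP; rewrite -[_ == _]Q0.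
    by rewrite -ii0; split=> //; apply/existsP; exists j'; rewrite A1.
  by exists i0; apply/existsP; exists j'; rewrite A1 lt A0 eqxx.
have v0 := vpart0 A j; have v1 := vpartS A i0 j; have h1 := hpartS A i0 j.
rewrite -[vpart A 0 j]/(vpart A i0 j) in v0.
have bA j' : bit (A i0 j').
  by have := cb 1%N j'; rewrite (vpartS A i0) vpart0 add0r.
rewrite bit_sum_pick ?rs //.
have sumA : \sum_(j' < n | (j < j')%N) A i0 j' = 1 - hpart A i0 j.+1.
  rewrite -(rs i0) [X in X - _](bigID (fun j' : 'I_n => (j' < j.+1)%N)) /= -/(hpart A i0 j.+1) addrAC subrr add0r.
  by apply: eq_bigl => j'; rewrite -leqNgt.
rewrite sumA /all_off v1 h1 v0 add0r.
by case/orP: (bA j) => /eqP->; case/orP: (rb i0 j) => /eqP->.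
Qed.

Lemma rhoL_sum A : asm_bits A ->
  rhoL A = (\sum_(i < n) \sum_(j < n) ((j == 0%N :> nat) && all_off A i j : nat))%N.
Proof.
move=> /asm_bits_tr/rhoT_sum E; rewrite exchange_big /=.
transitivity (rhoT A^T).
  apply: eq_card => i; rewrite !inE; apply: eq_existsb => j; apply: eq_existsb => i'.
  by rewrite !mxE.
rewrite E; apply: eq_bigr => j _; apply: eq_bigr => i _.
by rewrite all_off_tr.
Qed.

(** Dually, the edges below the bottom row are on, and the zeros after its 1 are the all-on
    vertices. *)
Lemma rhoB_sum A : asm_bits A ->
  rhoB A = (\sum_(i < n) \sum_(j < n) ((i.+1 == n) && all_on A i j : nat))%N.
Proof.
move=> [rb rs cb cs]; rewrite exchange_big /rhoB card_set_sum; apply: eq_bigr => j _.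
have n0 : (n.-1 < n)%N by rewrite prednK //; exact: leq_trans (ltn_ord j).
have n1 : n.-1.+1 = n by apply: ltn_predK n0.
have Q0 : (fun i : 'I_n => i.+1 == n) =1 pred1 (Ordinal n0).
  by move=> i; apply/eqP/eqP => [Ei|->]; [apply: val_inj; rewrite /= -[in RHS]Ei | exact: n1].
set i0 := Ordinal n0 in Q0; rewrite (sum_pick _ Q0); congr nat_of_bool.
transitivity ((A i0 j == 0) && [exists j', (A i0 j' == 1) && (j' < j)%N]).
  apply/existsP/andP => [[i /existsP[j' /and4P[i0i A1 lt A0]]]|[A0 /existsP[j' /andP[A1 lt]]]].
    have ii0 : i = i0 by apply/eqP; rewrite -[_ == _]Q0.
    by rewrite -ii0; split=> //; apply/existsP; exists j'; rewrite A1.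
  by exists i0; apply/existsP; exists j'; rewrite A1 lt A0 /= n1 eqxx.
have vS j' : vpart A i0.+1 j' = 1 by rewrite /= n1 vpart_full cs.
have h1 := hpartS A i0 j.
have vA j' : vpart A i0 j' = 1 - A i0 j' by rewrite -(vS j') vpartS addrK.
have bA j' : bit (A i0 j').
  have := cb i0 j'; rewrite vA /bit subr_eq0 eq_sym orbC; case/orP => [/eqP|->]; last by rewrite orbT.
  by rewrite -[RHS]subr0 => /addrI/oppr_inj ->.
rewrite bit_sum_pick ?rs // -/(hpart A i0 j) /all_on vS vA h1.
by case/orP: (bA j) => /eqP->; case/orP: (rb i0 j) => /eqP->.
Qed.

Lemma mu_sum A : asm_bits A -> mu A = (\sum_(i < n) \sum_(j < n) (drop_off A i j : nat))%N.
Proof.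
move=> [rb rs cb cs]; rewrite /mu card_set_sum pair_bigA /=.
apply: eq_bigr => -[i j] _ /=; congr nat_of_bool.
move: (rb i j) (rb i j.+1) (cb i j) (cb i.+1 j); rewrite /drop_off hpartS vpartS.
move: (hpart _ _ _) (vpart _ _ _) (A i j) => h v a.
rewrite /bit; lia.
Qed.

Lemma nu_sum A : asm_bits A -> nu A = (\sum_(i < n) \sum_(j < n) (all_on A i j : nat))%N.
Proof.
move=> [rb rs cb cs].
rewrite /nu; suff -> : nuz A = (\sum_(i < n) \sum_(j < n) (all_on A i j : nat))%N%:Z by [].
(* Grouping by the cell (i', j) collects the entries above it in its column and the entries up to it
   in its row. Both edges being on forces the vertex all on by the ice rule. *)
have -> : nuz A = \sum_(i < n) \sum_(j < n) vpart A i j * hpart A i j.+1.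
  rewrite /nuz (exchange_big_dep xpredT) //=; apply: eq_bigr => i' _.
  rewrite exchange_big /=; apply: eq_bigr => j _.
  by rewrite /vpart /hpart big_distrlr.
rewrite -natz natr_sum; apply: eq_bigr => i _.
rewrite natr_sum; apply: eq_bigr => j _.
move: (rb i j) (rb i j.+1) (cb i j) (cb i.+1 j); rewrite /all_on hpartS vpartS.
move: (hpart _ _ _) (vpart _ _ _) (A i j) => h v a.
rewrite natz /bit => /orP[]/eqP-> Hh /orP[]/eqP-> Hv; lia.
Qed.

End Statistics.

(* The column None is the left-most one, whose left edges are off; the entries with
   left edge on are irrelevant. *)
Definition tri_wt (R : comNzRingType) (x k z3 z : R) (c : option R) (h v h' v' : bool) : R :=
  if c is Some w then wt x k z w h v h' v' else
  match h, v, h', v' with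
  | false, false, false, false => z * z3
  | false, true, false, true | true, false, true, false | false, false, true, true => 1
  | _, _, _, _ => 0
  end.

(** A product, so that for n = 1 the only row, both first and last, gets both parameters. *)
Definition edge_row (R : comNzRingType) (n : nat) (z1 z2 : R) (i : nat) : R :=
  (if i == 0%N then z1 else 1) * (if i.+1 == n then z2 else 1).

Definition edge_col (R : comNzRingType) (j : nat) : option R :=
  if j == 0%N then None else Some 0.

Lemma tri_wt_ice (R : comNzRingType) (x k z3 z : R) c (h v h' v' : bool) :
  (h + v' != h' + v)%N -> tri_wt x k z3 z c h v h' v' = 0.
Proof. by case: c => [w|]; [exact: wt_ice | case: h v h' v' => -[] [] []]. Qed.

(** At column parameter 0 the non-turning weights are z, x z and 1. The top row has no all-on
    vertex, the bottom row no all-off one, and neither has a -1, so [z1] and [z2] count exactly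
    [rhoT] and [rhoB]. The column [None] adds [z3] for each all-off vertex. *)
Lemma state_prod_tri (R : comNzRingType) n (x y z1 z2 z3 : R) (A : 'M[int]_n) : asm_bits A ->
  \prod_(i < n) \prod_(j < n) tri_wt x (1 + x - y) z3 (edge_row n z1 z2 i) (edge_col R j)
     (hpart A i j == 1) (vpart A i j == 1) (hpart A i j.+1 == 1) (vpart A i.+1 j == 1)
  = x ^+ nu A * y ^+ mu A * z1 ^+ rhoT A * z2 ^+ rhoB A * z3 ^+ rhoL A.
Proof.
move=> bA; have [rb rs cb cs] := bA.
rewrite nu_sum // mu_sum // rhoT_sum // rhoB_sum // rhoL_sum //.
have powE t (F : 'I_n -> 'I_n -> nat) :
    t ^+ (\sum_(i < n) \sum_(j < n) F i j) = \prod_(i < n) \prod_(j < n) t ^+ F i j :> R.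
  by rewrite -prodrXr; apply: eq_bigr => i _; rewrite prodrXr.
rewrite !powE -!big_split /=; apply: eq_bigr => i _.
rewrite -!big_split /=; apply: eq_bigr => j _.
have h0 : j = 0%N :> nat -> hpart A i j = 0 by move=> ->; exact: hpart0.
have v0 : i = 0%N :> nat -> vpart A i j = 0 by move=> ->; exact: vpart0.
have vn : i.+1 = n -> vpart A i.+1 j = 1 by move=> ->; rewrite vpart_full.
move: (rb i j) (rb i j.+1) (cb i j) (cb i.+1 j) h0 v0 vn.
rewrite /all_on /all_off /drop_off /edge_row /edge_col hpartS vpartS.
move: (hpart _ _ _) (vpart _ _ _) (A i j) => h v a.
move=> /orP[]/eqP-> /orP[]/eqP Eh /orP[]/eqP-> /orP[]/eqP Ev; rewrite ?Eh ?Ev;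
  try (by exfalso; move: Eh Ev; clear; lia); move=> h0 v0 vn;
  case: (j =P 0%N :> nat) => [/h0 // | _]; case: (i =P 0%N :> nat) => [/v0 // | _];
  case: (i.+1 =P n) => [/vn // | _]; move=> * /=; rewrite /wtb /quadw ?expr0 ?expr1; ring.
Qed.

Lemma Ztri_dwbc (R : idomainType) n (x y z1 z2 z3 : R) :
  Ztri n x y z1 z2 z3 =
  dwbc (tri_wt x (1 + x - y) z3)
    [seq edge_row n z1 z2 i | i <- iota 0 n] [seq edge_col R j | j <- iota 0 n].
Proof.
pose L (i j : nat) := tri_wt x (1 + x - y) z3 (edge_row n z1 z2 i) (edge_col R j).
transitivity (dwbc L (iota 0 n) (iota 0 n)); last first.
  by rewrite /dwbc size_map; symmetry; exact: (part_map (phi := idfun)).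
rewrite dwbc_asm; last by move=> *; exact: tri_wt_ice.
apply: eq_bigr => A; rewrite inE => /is_asmP bA.
rewrite /state_prod /L state_prod_tri; last exact: bA (@int_mx_entries n A).
by rewrite expr1n mulr1.
Qed.

(** * Refinement along the first column *)

Section FirstColumn.

Variables (R : comNzRingType) (A B : Type).
Variable L : A -> B -> bool -> bool -> bool -> bool -> R.

Hypothesis ice : forall a b (h v h' v' : bool),
  (h + v' != h' + v)%N -> L a b h v h' v' = 0.

(* k is the row of the only 1 of the first column, which is left out. *)
Fixpoint col_coef rs cs k s : R :=
  match rs, k with
  | [::], _ => 0
  | r :: rs, 0%N =>
      \sum_(t <- words bits (size cs)) transfer L r cs true true s t * part L rs cs t
  | r :: rs, k.+1 =>
      \sum_(t <- words bits (size cs)) transfer L r cs false true s t * col_coef rs cs k t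
  end.

(** Sorted by the row of the 1 in the first column: vertices above it are all off, those below are
    vertical lines. The coefficients [col_coef] do not involve [c], so expansions for different
    first columns can be compared. *)
Lemma part_first_col a0 rs c cs s :
  part L rs (c :: cs) (false :: s) =
  \sum_(k < size rs)
    \prod_(r <- take k rs) L r c false false false false *
    L (nth a0 rs k) c false false true true *
    \prod_(r <- drop k.+1 rs) L r c false true false true * col_coef rs cs k s.
Proof.
elim: rs s => [|r rs IHrs] s; first by rewrite big_ord0.
rewrite (part_col_false ice) big_ord_recl /= big_nil mul1r drop0 addrC; congr (_ + _).
under eq_bigr do rewrite IHrs mulr_sumr.
rewrite exchange_big mulr_sumr; apply: eq_bigr => k _ /=.
rewrite big_cons !mulr_sumr; apply: eq_bigr => t _ /=; ring.
Qed.

Lemma dwbc_first_col a0 rs c cs :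
  dwbc L rs (c :: cs) =
  \sum_(k < size rs)
    \prod_(r <- take k rs) L r c false false false false *
    L (nth a0 rs k) c false false true true *
    \prod_(r <- drop k.+1 rs) L r c false true false true *
    col_coef rs cs k (nseq (size cs) false).
Proof. exact: part_first_col. Qed.

Lemma col_coef0 r rs cs :
  col_coef (r :: rs) cs 0 (nseq (size cs) false) =
  \prod_(c <- cs) L r c true false true false * dwbc L rs cs.
Proof. exact: sum_transfer_frozen. Qed.

Lemma sum_transfer_full r cs s : size s = size cs ->
  \sum_(t <- words bits (size cs)) transfer L r cs true true s t * (all id t)%:R =
  \prod_(c <- cs) L r c true true true true * (all id s)%:R.
Proof.
elim: cs s => [|c cs IHcs] [|v s] //=; first by rewrite big_words0 big_nil.
move=> [ss]; rewrite big_words big_bits [X in _ + X]big1 ?addr0; last by move=> t _; rewrite mulr0.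
rewrite big_cons -mulrA -[X in _ = _ * X]/(_ * (v && all id s)%:R).
transitivity (L r c true v true true *
   \sum_(t <- words bits (size cs)) transfer L r cs true true s t * (all id t)%:R).
  rewrite mulr_sumr; apply: eq_bigr => t _; rewrite big_bits /= mulrA.
  by rewrite (@ice _ _ _ _ false) ?mul0r ?addr0 //; case: v.
by rewrite IHcs //; case: v => /=; rewrite ?mulr0 // ice ?mul0r.
Qed.

(** If the 1 of the first column is in the last row, that row has its left and bottom edges on,
    hence is all on. *)
Lemma col_coef_last r rs cs s : size s = size cs ->
  col_coef (rcons rs r) cs (size rs) s =
  \prod_(c <- cs) L r c true true true true * part L rs cs s.
Proof.
elim: rs s => [|r' rs IHrs] s ss /=; first exact: sum_transfer_full.
by rewrite mulr_sumr; apply: eq_big_words => t st; rewrite IHrs // mulrCA.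
Qed.

End FirstColumn.

Lemma prod_nseq (R : comNzRingType) (T : Type) (F : T -> R) m a :
  \prod_(r <- nseq m a) F r = F a ^+ m.
Proof. by elim: m => [|m IHm]; rewrite ?big_nil // big_cons IHm exprS. Qed.

(** * Trading the weight of the left-most column for a column parameter *)

Section Conversion.

Variables (F : idomainType) (x y : F).
Let k := 1 + x - y.

Lemma dwbc_tri_Z6v z3 rs ws : dwbc (tri_wt x k z3) rs (map Some ws) = Z6v x k rs ws.
Proof.
rewrite /Z6v /dwbc size_map -[X in part _ X _ _](map_id rs).
exact: (part_map (phi := idfun)).
Qed.

Lemma map_const_in (T : eqType) (U : Type) (f : T -> U) (a : U) s :
  {in s, forall t, f t = a} -> map f s = nseq (size s) a.
Proof.
elim: s => //= t s IHs fa; rewrite fa ?mem_head // IHs // => u us.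
by apply: fa; rewrite inE us orbT.
Qed.

Lemma edge_cols m : [seq edge_col F j | j <- iota 0 m.+1] = None :: map Some (nseq m (0 : F)).
Proof.
rewrite /= map_nseq (map_const_in (a := Some 0)) ?size_iota // => j.
by rewrite mem_iota /edge_col; case: j.
Qed.

Lemma edge_rows (z1 z2 : F) m :
  [seq edge_row m.+2 z1 z2 i | i <- iota 0 m.+2] = z1 :: rcons (nseq m 1) z2.
Proof.
have -> : iota 0 m.+2 = 0%N :: rcons (iota 1 m) m.+1.
  by rewrite -cats1 -[[:: m.+1]]/(iota (1 + m) 1) -iotaD addn1.
rewrite /= map_rcons.
rewrite (map_const_in (a := 1)) ?size_iota => [|i]; last first.
  rewrite mem_iota /edge_row => /andP[i0 im]; rewrite (gtn_eqF i0) ifF ?mulr1 //.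
  by apply/negbTE; lia.
by rewrite /edge_row /= !eqxx mul1r mulr1.
Qed.

Lemma edge_rows1 (z : F) m : [seq edge_row m.+1 z 1 i | i <- iota 0 m.+1] = z :: nseq m 1.
Proof.
have E i : edge_row m.+1 z 1 i = if i == 0%N then z else 1.
  by rewrite /edge_row; case: (_ == m.+1); rewrite mulr1.
rewrite (eq_map E) /= (map_const_in (a := 1)) ?size_iota // => i.
by rewrite mem_iota; case: i.
Qed.

(** For z3 = 1 and left edges off, the column [None] has the weights of a column of parameter 0. *)
Lemma Zref_Z6v m z : Zref m.+1 x y z = Z6v x k (z :: nseq m 1) (nseq m.+1 0).
Proof.
rewrite -[LHS]/(Ztri m.+1 x y z 1 1) Ztri_dwbc edge_rows1 edge_cols -(dwbc_tri_Z6v 1).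
rewrite -[map Some (nseq m.+1 _)]/(Some (0 : F) :: map Some (nseq m 0)).
rewrite !(dwbc_first_col (@tri_wt_ice _ x k 1) 0).
apply: eq_bigr => j _; congr (_ * _ * _ * _).
  by apply: eq_bigr => r _; rewrite /= mulr1 subr0.
by apply: eq_bigr => r _; rewrite /= /wtb !mulr0 subr0 addr0.
Qed.

(** Separates the two corner positions of the 1; only at the positions in between do the columns
    [Some w] and [None] get proportional weights in [Ztri_Z6v]. *)
Lemma expand_col (z3 z1 z2 : F) m c (Y : nat -> F) :
  let L := tri_wt x k z3 in
  \sum_(j < m.+2)
    \prod_(r <- take j (z1 :: rcons (nseq m 1) z2)) L r c false false false false *
    L (z1 :: rcons (nseq m 1) z2)`_j c false false true true *
    \prod_(r <- drop j.+1 (z1 :: rcons (nseq m 1) z2)) L r c false true false true * Y j =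
  L 1 c false true false true ^+ m * L z2 c false true false true * Y 0%N
  + \sum_(i < m) L z1 c false false false false * L 1 c false false false false ^+ i *
      (L 1 c false true false true ^+ (m - i.+1) * L z2 c false true false true) * Y i.+1
  + L z1 c false false false false * L 1 c false false false false ^+ m * Y m.+1.
Proof.
move=> L; have L1 r : L r c false false true true = 1 by case: (c).
rewrite big_ord_recl big_ord_recr /= addrA; congr (_ + _ + _).
- by rewrite L1 big_nil !mul1r drop0 big_rcons prod_nseq /= mulrC.
- apply: eq_bigr => i _; rewrite L1 mulr1 !add0n /bump /= add1n.
  rewrite big_cons drop_rcons ?size_nseq // drop_nseq big_rcons prod_nseq.
  by rewrite -cats1 takel_cat ?size_nseq 1?ltnW // take_nseq 1?ltnW // prod_nseq.
- rewrite L1 mulr1 !add0n big_cons -cats1 takel_cat ?size_nseq // take_nseq // prod_nseq.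
  by rewrite /bump /= add1n drop_oversize ?big_nil ?mulr1 // size_cat size_nseq addn1.
Qed.

(** The condition on [w] makes [z3] the ratio of the all-off weight to the vertical weight in a row
    of parameter 1. The column [w] then counts [rhoL] up to a constant factor, and the last two
    terms correct the corner positions of the 1. *)
Lemma Ztri_Z6v m z1 z2 z3 w : 1 - w = wtb x k 1 w * z3 ->
  wtb x k 1 w * z1 * z3 * Z6v x k (z1 :: z2 :: nseq m 1) (w :: nseq m.+1 0) =
  wtb x k 1 w ^+ m *
   ((z1 - w) * wtb x k z2 w * Ztri m.+2 x y z1 z2 z3
    + (wtb x k 1 w * z1 * z3 - (z1 - w)) * wtb x k z2 w * Zref m.+1 x y z2
    + (z1 - w) * (wtb x k 1 w - wtb x k z2 w) * z1 * (z3 * (x * z2)) ^+ m.+1 * Zref m.+1 x y z1).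
Proof.
move=> Ew; set p := wtb x k 1 w in Ew *; set q := wtb x k z2 w.
have rowsE : perm_eq (z1 :: z2 :: nseq m 1) (z1 :: rcons (nseq m 1) z2).
  by rewrite perm_cons perm_sym perm_rcons.
rewrite (perm_Z6v _ _ _ rowsE) -(dwbc_tri_Z6v z3) Ztri_dwbc edge_rows edge_cols.
(* The coefficients shared by both first columns; the extreme ones, [Y 0] and [Y m.+1], reduce to
   [Zref] of size m + 1. *)
pose Y j := col_coef (tri_wt x k z3) (z1 :: rcons (nseq m 1) z2) (map Some (nseq m.+1 (0 : F))) j
  (nseq m.+1 false).
have Y0 : Y 0%N = Zref m.+1 x y z2.
  have := col_coef0 (@tri_wt_ice _ x k z3) z1 (rcons (nseq m 1) z2) (map Some (nseq m.+1 (0 : F))).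
  rewrite size_map size_nseq -/(Y 0%N) => ->; rewrite big1_seq ?mul1r; last first.
    move=> c /andP[_ /mapP[u]]; rewrite mem_nseq => /andP[_ /eqP->] ->.
    by rewrite /= /wtb !mulr0 subr0 addr0.
  by rewrite dwbc_tri_Z6v Zref_Z6v; apply: perm_Z6v; rewrite perm_rcons.
have Ym : Y m.+1 = (x * z2) ^+ m.+1 * Zref m.+1 x y z1.
  have := col_coef_last (@tri_wt_ice _ x k z3) z2 (z1 :: nseq m 1) (cs := map Some (nseq m.+1 (0 : F)))
    (s := nseq m.+1 false).
  have -> : size (z1 :: nseq m 1) = m.+1 by rewrite /= size_nseq.
  rewrite rcons_cons size_map !size_nseq -/(Y m.+1) => -> //.
  rewrite Zref_Z6v -(dwbc_tri_Z6v z3) /dwbc size_map size_nseq.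
  by rewrite big_map prod_nseq /= subr0.
rewrite -[map Some (w :: _)]/(Some w :: map Some (nseq m.+1 0)).
rewrite !(dwbc_first_col (@tri_wt_ice _ x k z3) 0) !size_map !size_nseq.
have -> : size (z1 :: rcons (nseq m 1) z2) = m.+2 by rewrite /= size_rcons size_nseq.
rewrite (expand_col z3 z1 z2 m (Some w) Y) (expand_col z3 z1 z2 m None Y) Y0 Ym /= -/p -/q.
pose S := \sum_(i < m) z3 ^+ i * Y i.+1.
set S1 := (X in _ * (_ + X + _) = _).
(* Substituting p z3 for 1 - w makes the power of [p] the same in all inner terms. *)
have ES1 : p * S1 = (z1 - w) * q * p ^+ m * S.
  rewrite !mulr_sumr; apply: eq_bigr => i _; rewrite Ew exprMn.
  have -> : p ^+ m = p ^+ i.+1 * p ^+ (m - i.+1) by rewrite -exprD subnKC.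
  by rewrite exprS; ring.
set S2 := (X in _ * (_ * (_ + X + _) + _ + _)).
have ES2 : S2 = z1 * z3 * S.
  by rewrite mulr_sumr; apply: eq_bigr => i _; rewrite mul1r expr1n !mulr1 mulrA.
rewrite ES2 Ew mul1r expr1n !exprMn !exprS.
transitivity (z1 * z3 * (p * S1) + p * z1 * z3 * (p ^+ m * q * Zref m.+1 x y z2 +
   (z1 - w) * (p ^+ m * z3 ^+ m) * (x * x ^+ m * (z2 * z2 ^+ m) * Zref m.+1 x y z1))).
  by ring.
by rewrite ES1; ring.
Qed.

End Conversion.

(** * The relation for generating functions *)

Lemma Zadjt_Ztri (R : comNzRingType) n (x y z1 z2 : R) :
  Zadjt n x y z1 z2 = Ztri n x y 1 z1 z2.
Proof. exact: Zquad_rot. Qed.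

Definition tri_relation (R : comNzRingType) n (x y z1 z2 z3 : R) :=
  y * (z2 - z1) * z3 * Ztri n x y z1 z2 z3 * Zasm n.-1 x y =
    (z1 - 1) * ((z2 - 1) * (z3 - 1) - y * z2 * z3)
      * Zadj n x y z1 z3 * Zref n.-1 x y z2
    - (z2 - 1) * (x * (z1 - 1) * (z3 - 1) - y) * z1 * z3
      * Zadjt n x y z2 z3 * Zref n.-1 x y z1
    - (z1 - 1) * (z2 - 1) * (z3 - 1) * Zref n.-1 x y z2 * Zasm n.-1 x y
    + (z1 - 1) * (z2 - 1) * (z3 - 1) * z1 * z2 ^+ n.-1 * (x * z3) ^+ n
      * Zref n.-1 x y z1 * Zasm n.-1 x y.

(** The three-term relation for the rows z1, z2 and 1, converted by [Ztri_Z6v]. The hypotheses say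
    that [w0], [p], [z1 - w] and [q z2], which are divided out, are nonzero. *)
Lemma tri_relation_field (F : fieldType) m (x y z1 z2 z3 : F) :
  1 - (1 - y) * z3 != 0 -> y != 0 ->
  y * z1 * z3 - (z1 - 1) * (z3 - 1) != 0 -> y - x * (z2 - 1) * (z3 - 1) != 0 ->
  tri_relation m.+2 x y z1 z2 z3.
Proof.
set w0 := 1 - (1 - y) * z3 => w0_neq0 y_neq0 P_neq0 q_neq0.
(* Since [wtb x k 1 w] is 1 - (1 - y) w, the condition of [Ztri_Z6v] is linear in [w], with solution
   (1 - z3) / w0; [p] is the value of [wtb x k 1 w] there. *)
pose k := 1 + x - y; pose p := y / w0.
have p_neq0 : p != 0 by rewrite mulf_neq0 ?invr_eq0.
pose w := 1 - p * z3; pose q z := p + x * (z - 1) * w.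
have wE : w = (1 - z3) / w0 by rewrite /w /p /w0; field.
have Ep z : wtb x k z w = q z.
  by rewrite /q wE /wtb /k /p /w0; field.
have Eq1 : q 1 = p by rewrite /q; ring.
have Pw : z1 - w != 0.
  have -> : z1 - w = (y * z1 * z3 - (z1 - 1) * (z3 - 1)) / w0 by rewrite wE /w0; field.
  by rewrite mulf_neq0 ?invr_eq0.
have qw : q z2 != 0.
  have -> : q z2 = (y - x * (z2 - 1) * (z3 - 1)) / w0 by rewrite /q wE /p /w0; field.
  by rewrite mulf_neq0 ?invr_eq0.
have Ew : 1 - w = wtb x k 1 w * z3 by rewrite Ep Eq1 /w; ring.
have C12 := Ztri_Z6v m z1 z2 Ew.
have C1 := Ztri_Z6v m 1 z2 Ew.
have C2 := Ztri_Z6v m z1 1 Ew.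
have := @Z6v_three_term _ x k z1 z2 1 w (nseq m 1) (nseq m.+1 0).
rewrite !size_nseq => /(_ erefl); rewrite /three_term.
(* The rows are reordered to match [C1] and [C2]. *)
rewrite (perm_Z6v _ _ (zs := [:: z2, 1 & nseq m 1]) (zs' := [:: 1, z2 & nseq m 1])); last first.
  by rewrite -[z2 :: _]/([:: z2] ++ [:: 1] ++ nseq m 1) perm_catCA.
rewrite (perm_Z6v _ _ (zs := [:: 1, z1 & nseq m 1]) (zs' := [:: z1, 1 & nseq m 1])); last first.
  by rewrite -[1 :: _]/([:: 1] ++ [:: z1] ++ nseq m 1) perm_catCA.
rewrite -!Zref_Z6v /wtab !Ep !Eq1 in C12 C1 C2 *.
move: C12 C1 C2; set X12 := Z6v _ _ _ _; set X1 := Z6v _ _ _ _; set X2 := Z6v _ _ _ _.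
move=> C12 C1 C2 T.
rewrite /tri_relation Zadjt_Ztri -[Zadj _ _ _ _ _]/(Ztri m.+2 x y z1 1 z3).
rewrite -[Zasm _ _ _]/(Zref m.+1 x y 1) [_.-1]/=.
(* Exposes the power occurring in [Ztri_Z6v], so that it can be generalized to [K] before the ring
   computation. *)
have EK : z2 ^+ m.+1 * (x * z3) ^+ m.+2 = x * z3 * (z3 * (x * z2)) ^+ m.+1.
  by rewrite [(x * z3) ^+ m.+2]exprS mulrCA -exprMn; congr (_ * _ ^+ _); ring.
rewrite -[_ * z2 ^+ m.+1 * _]mulrA EK.
move: C12 C1 C2 T; set K := _ ^+ m.+1; set K' := (z3 * (x * 1)) ^+ m.+1; move: K K'.
move: X12 X1 X2 (Ztri _ _ _ z1 z2 z3) (Ztri _ _ _ 1 z2 z3) (Ztri _ _ _ z1 1 z3).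
move: (Zref _ _ _ z1) (Zref _ _ _ z2) (Zref _ _ _ 1).
move=> Ea Eb E1 X12 X1 X2 t12 t1 t2 K K' C12 C1 C2 T.
(* [G] is the three-term relation with [X12], [X1], [X2] eliminated and the nonzero factor [nz]
   divided out. *)
pose G := p * z3 * (z1 - z2) * t12 * E1 + (z2 - 1) * q z1 * z1 * z3 * t1 * Ea
  + (1 - z1) * (z2 - w) * t2 * Eb + (p * z1 * z3 - (z1 - w)) * (1 - z2) * E1 * Eb
  + z3 * (p - q z2) * (z1 - 1) * z1 * K * E1 * Ea.
have G0 : G = 0.
  have nz : p ^+ m * ((z1 - w) * q z2 * p) != 0 by do !apply: mulf_neq0 => //; apply: expf_neq0.
  apply: (mulfI nz); rewrite mulr0.
  transitivity ((z1 - z2) * ((1 - w) * p) * E1 * (p * z1 * z3 * X12)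
    + (z2 - 1) * ((z1 - w) * q z1) * Ea * z1 * (p * 1 * z3 * X1)
    + (1 - z1) * ((z2 - w) * q z2) * Eb * (p * z1 * z3 * X2)).
    by rewrite C12 C1 C2 /G /q /w; move: (p ^+ m) => pm; ring.
  rewrite -(mulr0 (p * z1 * z3)) -T; ring.
apply/eqP; rewrite -subr_eq0; apply/eqP.
(* The factor [w0] clears the denominators of [p] and [w]. *)
transitivity (- (w0 * G)); last by rewrite G0 mulr0 oppr0.
by rewrite /G /q wE /p /w0; field.
Qed.

Lemma Zquad_map (R S : comNzRingType) (phi : {rmorphism R -> S}) n x y z1 z2 z3 z4 :
  phi (Zquad n x y z1 z2 z3 z4) = Zquad n (phi x) (phi y) (phi z1) (phi z2) (phi z3) (phi z4).
Proof. by rewrite rmorph_sum; apply: eq_bigr => A _; rewrite !rmorphM !rmorphXn. Qed.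

Theorem corollary4 (n : nat) (hn : (2 <= n)%N) :
  let x  : {mpoly int[5]} := 'X_(0 : 'I_5) in
  let y  : {mpoly int[5]} := 'X_(1 : 'I_5) in
  let z1 : {mpoly int[5]} := 'X_(2 : 'I_5) in
  let z2 : {mpoly int[5]} := 'X_(3 : 'I_5) in
  let z3 : {mpoly int[5]} := 'X_(4 : 'I_5) in
  y * (z2 - z1) * z3 * Ztri n x y z1 z2 z3 * Zasm n.-1 x y =
    (z1 - 1) * ((z2 - 1) * (z3 - 1) - y * z2 * z3)
      * Zadj n x y z1 z3 * Zref n.-1 x y z2
    - (z2 - 1) * (x * (z1 - 1) * (z3 - 1) - y) * z1 * z3
      * Zadjt n x y z2 z3 * Zref n.-1 x y z1
    - (z1 - 1) * (z2 - 1) * (z3 - 1) * Zref n.-1 x y z2 * Zasm n.-1 x y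
    + (z1 - 1) * (z2 - 1) * (z3 - 1) * z1 * z2 ^+ n.-1 * (x * z3) ^+ n
      * Zref n.-1 x y z1 * Zasm n.-1 x y.
Proof.
move=> x y z1 z2 z3.
case: n hn => [|[|m]] // _.
(* Each of the four polynomials required to be nonzero takes the value 1 when all variables are
   1. *)
have nz (p : {mpoly int[5]}) : p.@[fun=> 1] = 1 -> tofrac p != 0.
  move=> p1; rewrite tofrac_eq0; apply/eqP => p0.
  by move: p1; rewrite p0 meval0 => /eqP; rewrite eq_sym oner_eq0.
have X1 (i : 'I_5) : ('X_i : {mpoly int[5]}).@[fun=> 1] = 1 by rewrite mevalXU.
have frac : tri_relation m.+2 (tofrac x) (tofrac y) (tofrac z1) (tofrac z2) (tofrac z3).
  apply: tri_relation_field.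
  - have := nz (1 - (1 - y) * z3); rewrite !(rmorph1, rmorphB, rmorphM) /=; apply.
    by rewrite !X1 subrr mul0r subr0.
  - exact: nz (X1 _).
  - have := nz (y * z1 * z3 - (z1 - 1) * (z3 - 1)).
    rewrite !(rmorph1, rmorphB, rmorphM) /=; apply.
    by rewrite !X1 subrr mul0r subr0.
  - have := nz (y - x * (z2 - 1) * (z3 - 1)).
    rewrite !(rmorph1, rmorphB, rmorphM) /=; apply.
    by rewrite !X1 subrr !mulr0 subr0.
(* The polynomial ring embeds in its fraction field, and [Zquad] commutes with ring morphisms. *)
apply/eqP; rewrite -tofrac_eq; apply/eqP; move: frac.
rewrite /tri_relation /Ztri /Zadj /Zadjt /Zref /Zasm -(rmorph1 (@tofrac _)) -!Zquad_map.
by rewrite -!(rmorphB, rmorphM, rmorphXn, rmorphD).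
Qed.
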